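(* Let $\Sigma^2 \subseteq \mathbb{R}^{3}$ be a connected, properly immersed translater such that $\Sigma \subset \mathcal{H}$, where $\mathcal{H}$ is a vertical halfspace. Assume that $\Sigma$ is $1$-periodic in the $e_3$-direction, i.e. there exists $a > 0$ such that $\Sigma = \Sigma + a e_{3}$. Then $\Sigma$ is a vertical plane.
   Context: A translater (translating soliton of the mean curvature flow) is a smooth surface $\Sigma^2$ immersed in $\mathbb{R}^3$ (without boundary) satisfying $H = -\langle \nu, e_3\rangle$, where $\nu$ is a smooth unit normal vector field on $\Sigma$ and $H$ is the mean curvature (the sum of the principal curvatures), with sign convention such that the mean curvature vector is $-H\nu$; equivalently, the mean curvature vector equals $e_3^{\perp}$, the normal component of $e_3$. A plane in $\mathbb{R}^3$ is vertical if it is parallel to $e_3$; a halfspace $\mathcal{H}\subseteq\mathbb{R}^3$ is vertical if its boundary plane $\partial\mathcal{H}$ is vertical. *)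

(* Defs.v *)
From HB Require Import structures.
From mathcomp Require Import all_boot all_order all_algebra.
From mathcomp Require Import all_classical all_reals all_analysis.

Set Implicit Arguments.
Unset Strict Implicit.
Unset Printing Implicit Defensive.
Import Order.TTheory GRing.Theory Num.Theory.
Import numFieldNormedType.Exports.
Local Open Scope classical_set_scope.
Local Open Scope ring_scope.

Section Euclidean.
Context {R : realType}.

(* The library norm on row vectors is the sup norm, which is used here only
   for its topology; Euclidean geometry goes through this inner product. *)
Definition dot (n : nat) (u v : 'rV[R]_n) : R := \sum_(i < n) u 0 i * v 0 i.

Definition e3 : 'rV[R]_3 := delta_mx 0 (@Ordinal 3 2 isT).

Definition plane (n : 'rV[R]_3) (c : R) : set 'rV[R]_3 := [set x | dot n x = c].

Definition halfspace (n : 'rV[R]_3) (c : R) : set 'rV[R]_3 :=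
  [set x | c <= dot n x].

Definition parallel_to (v : 'rV[R]_3) (P : set 'rV[R]_3) : Prop :=
  forall (x : 'rV[R]_3) (t : R), P x -> P (x + t *: v).

Definition vertical_plane (P : set 'rV[R]_3) : Prop :=
  exists n c, [/\ n != 0, P = plane n c & parallel_to e3 P].

(* The boundary of [halfspace n c] is [plane n c]. *)
Definition vertical_halfspace (Hs : set 'rV[R]_3) : Prop :=
  exists n c, [/\ n != 0, Hs = halfspace n c & vertical_plane (plane n c)].

End Euclidean.

Section Smooth.
Context {R : realType} {m n : nat}.

(* [f] is [k] times differentiable on the open set [U] (and continuous); the
   values of [f] and of its derivatives outside [U] are irrelevant. *)
Fixpoint diff_upto (k : nat) (U : set 'rV[R]_m.+1)
    (f : 'rV[R]_m.+1 -> 'rV[R]_n.+1) : Prop :=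
  if k is k'.+1 then
    (forall x, U x -> differentiable f x) /\
    (forall v : 'rV[R]_m.+1, diff_upto k' U ('D_v f))
  else forall x, U x -> {for x, continuous f}.

Definition smooth_on (U : set 'rV[R]_m.+1) (f : 'rV[R]_m.+1 -> 'rV[R]_n.+1) :=
  forall k, diff_upto k U f.

End Smooth.

Record chart (R : realType) (M : topologicalType) := Chart {
  cdom : set M;
  ccod : set 'rV[R]_2;
  coord : M -> 'rV[R]_2;
  param : 'rV[R]_2 -> M;
  cdom_open : open cdom;
  ccod_open : open ccod;
  coord_ccod : forall p, cdom p -> ccod (coord p);
  param_cdom : forall u, ccod u -> cdom (param u);
  coordK : forall p, cdom p -> param (coord p) = p;
  paramK : forall u, ccod u -> coord (param u) = u;
  coord_cts : forall p, cdom p -> {for p, continuous coord};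
  param_cts : forall u, ccod u -> {for u, continuous param}
}.

Section Surface.
Context {R : realType} {M : topologicalType}.
Implicit Types (A : set (chart R M)) (F nu : M -> 'rV[R]_3).

Definition smooth_atlas A : Prop :=
  (forall p, exists2 c, A c & cdom c p) /\
  (forall c c', A c -> A c' ->
     smooth_on (ccod c `&` param c @^-1` cdom c') (coord c' \o param c)).

Definition smooth_surface A : Prop :=
  [/\ hausdorff_space M, @second_countable M & smooth_atlas A].

Definition smooth_map_on A (D : set M) F : Prop :=
  forall c, A c -> smooth_on (ccod c `&` param c @^-1` D) (F \o param c).

Definition immersion A F : Prop :=
  smooth_map_on A setT F /\
  (forall c u, A c -> ccod c u ->
     injective ('d (F \o param c) u : 'rV[R]_2 -> 'rV[R]_3)).

Definition proper_map F : Prop :=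
  forall K : set 'rV[R]_3, compact K -> compact (F @^-1` K).

End Surface.

Section Curvature.
Context {R : realType}.
Implicit Types (X : 'rV[R]_2 -> 'rV[R]_3) (nu : 'rV[R]_3) (u : 'rV[R]_2).

Definition basis_vec (i : 'I_2) : 'rV[R]_2 := delta_mx 0 i.

Definition first_form X u : 'M[R]_2 :=
  \matrix_(i, j) dot ('D_(basis_vec i) X u) ('D_(basis_vec j) X u).

(* The sign is the one for which the mean curvature vector is [- H nu]: the
   unit sphere has H = 2 with respect to its outward normal. *)
Definition second_form X nu u : 'M[R]_2 :=
  \matrix_(i, j) - dot ('D_(basis_vec i) ('D_(basis_vec j) X) u) nu.

Definition shape_operator X nu u : 'M[R]_2 :=
  invmx (first_form X u) *m second_form X nu u.

(* [k1] and [k2] are the eigenvalues of the shape operator, with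
   multiplicity. *)
Definition principal_curvatures X nu u (k1 k2 : R) : Prop :=
  char_poly (shape_operator X nu u) = ('X - k1%:P) * ('X - k2%:P).

Definition is_mean_curvature X nu u (H : R) : Prop :=
  exists k1 k2, principal_curvatures X nu u k1 k2 /\ H = k1 + k2.

End Curvature.

Section Translater.
Context {R : realType} {M : topologicalType}.
Implicit Types (A : set (chart R M)) (F nu : M -> 'rV[R]_3).

Definition unit_normal_field A (D : set M) F nu : Prop :=
  [/\ smooth_map_on A D nu,
      forall p, D p -> dot (nu p) (nu p) = 1 &
      forall c u, A c -> ccod c u -> D (param c u) ->
        forall v : 'rV[R]_2, dot (nu (param c u)) ('D_v (F \o param c) u) = 0].

(* The equation H = - <nu, e3> does not depend on the sign of nu, so nu is only
   required to exist near each point: the surface need not be orientable. *)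
Definition translater A F : Prop :=
  forall p : M, exists D nu,
    [/\ open D, D p, unit_normal_field A D F nu &
        forall c u, A c -> ccod c u -> D (param c u) ->
          is_mean_curvature (F \o param c) (nu (param c u)) u
            (- dot (nu (param c u)) e3)].

End Translater.

(* Main.v *)
Require Import Defs.
From HB Require Import structures.
From mathcomp Require Import all_boot all_order all_algebra.
From mathcomp Require Import all_classical all_reals all_analysis.
From mathcomp Require Import ring lra.
Import Order.TTheory GRing.Theory Num.Theory.
Import numFieldNormedType.Exports.
Local Open Scope classical_set_scope.
Local Open Scope ring_scope.
Set Implicit Arguments.
Unset Strict Implicit.
Unset Printing Implicit Defensive.

(* Let [n] be the unit normal of the halfspace, [m] its rotation by a right
   angle around the vertical axis, and [X], [Y], [Z] the coordinates of [F] in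
   the frame [n, m, e3]. Along a translater the drift Laplacian of a function
   [u] of the position is the trace of the Hessian of [u] over the tangent
   plane plus [d_z u]. Hence no quadratic [u] for which this quantity is
   negative on the planes orthogonal to [grad u] can have a local minimum on
   the surface:
   - with [u = X + eta (Y - B) (b - Y)], the minimum of [X] over the strip
     [|Y| <= B], which exists by properness and periodicity, is a global
     minimum of [X];
   - with [u = X - eps (t + K t^2 - C s^2)], a Hopf barrier whose bracket is
     positive in a parabolic region inside a disc, the set where the minimum
     is attained projects onto the whole plane, since otherwise a largest
     empty disc would touch it;
   - the same argument on a small sheet of the surface, where [(Y, Z)] is
     injective, shows that this set is open in [M], hence equal to [M]. *)

(** * Minima of quadratic test functions along the surface *)

Section Compactness.
Context {R : realType} {M : topologicalType}.
Implicit Types (f g X Y Z : M -> R) (E : set M).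

Lemma closed_le_cts f g : continuous f -> continuous g ->
  closed [set p | f p <= g p].
Proof.
move=> cf cg; rewrite (_ : mkset _ = (g \- f) @^-1` [set x | 0 <= x]).
  apply: closed_comp (@closed_ge _ _) => p _.
  by apply: continuousB; [exact: cg|exact: cf].
by apply/seteqP; split=> p /=; rewrite subr_ge0.
Qed.

Lemma near_lt_cts f g p : continuous f -> continuous g -> f p < g p ->
  \forall q \near p, f q < g q.
Proof.
move=> cf cg fg; suff /open_nbhs_nbhs : open_nbhs p [set q | f q < g q] by [].
split=> //; rewrite -[X in open X]setCK openC.
rewrite (_ : ~` _ = [set q | g q <= f q]); first exact: closed_le_cts.
by apply/seteqP; split=> q /=; rewrite leNgt => /negP.
Qed.

Lemma compact_min E f p : compact E -> continuous f -> E p ->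
  exists2 p0, E p0 & forall q, E q -> f p0 <= f q.
Proof.
move=> cE cf Ep.
have [||p0 /set_mem Ep0 minp0] := compact_EVT_min _ cE (f := f).
- by exists p.
- exact: continuous_subspaceT.
by exists p0 => // q Eq; apply: minp0; exact: mem_set.
Qed.

(** Properness, expressed through the three coordinate functions alone. *)
Definition boxes_compact X Y Z := forall L : R,
  compact [set p | [/\ `|X p| <= L, `|Y p| <= L & `|Z p| <= L]].

Lemma boxes_compactN X Y Z :
  boxes_compact X Y Z -> boxes_compact X (fun p => - Y p) Z.
Proof.
move=> bc L; rewrite (_ : mkset _ =
  [set p | [/\ `|X p| <= L, `|Y p| <= L & `|Z p| <= L]]) //.
by apply/seteqP; split=> p /=; rewrite normrN.
Qed.

Lemma closed_box X Y Z x1 x2 y1 y2 z1 z2 :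
    continuous X -> continuous Y -> continuous Z ->
  closed [set p | [/\ x1 <= X p <= x2, y1 <= Y p <= y2 & z1 <= Z p <= z2]].
Proof.
move=> cX cY cZ.
have cl f a b : continuous f -> closed [set p | a <= f p <= b].
  move=> cf; rewrite (_ : mkset _ = [set p | a <= f p] `&` [set p | f p <= b]).
    by apply: closedI; apply: closed_le_cts => // p; exact: cst_continuous.
  by apply/seteqP; split=> p /=; [move/andP|move=> [-> ->]].
rewrite (_ : mkset _ = [set p | x1 <= X p <= x2] `&`
  ([set p | y1 <= Y p <= y2] `&` [set p | z1 <= Z p <= z2])).
  by apply: closedI; [exact: cl|apply: closedI; exact: cl].
by apply/seteqP; split=> p /=; [move=> [? ? ?]|move=> [? [? ?]]].
Qed.

Lemma compact_box X Y Z x1 x2 y1 y2 z1 z2 :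
    continuous X -> continuous Y -> continuous Z -> boxes_compact X Y Z ->
  compact [set p | [/\ x1 <= X p <= x2, y1 <= Y p <= y2 & z1 <= Z p <= z2]].
Proof.
move=> cX cY cZ bc.
pose L := `|x1| + `|x2| + `|y1| + `|y2| + `|z1| + `|z2|.
apply: (subclosed_compact _ (bc L)); first exact: closed_box.
move=> p /=.
have ub (s a b : R) : a <= s <= b -> `|s| <= `|a| + `|b|.
  by move=> /andP[? ?]; rewrite ler_norml; apply/andP; split;
    have := ler_norm b; have := ler_norm (- a); rewrite normrN;
    have := normr_ge0 a; have := normr_ge0 b; lra.
move=> [/ub Xp /ub Yp /ub Zp]; have := normr_ge0 x1; have := normr_ge0 x2.
have := normr_ge0 y1; have := normr_ge0 y2; have := normr_ge0 z1.
by have := normr_ge0 z2; rewrite /L; split; lra.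
Qed.

End Compactness.

Section Touching.
Context {R : realType} {M : topologicalType}.
Implicit Types (X Y Z : M -> R).

Definition quad (al be a b d y z : R) : R :=
  al * y + be * z + a * y ^+ 2 + 2 * b * y * z + d * z ^+ 2.

(* If [u = X + quad (Y, Z)], read as a function on space with gradient
   [G = (1, gy, gz)] and Hessian [H], has a local minimum along the surface,
   then [0 <= |G|^2 (tr H + d_z u) - H(G, G)]: on a translater this is
   [|G|^2] times the drift Laplacian of [u]. *)
Definition touching X Y Z := forall (al be a b d : R) (p : M),
  (\forall q \near p, X p + quad al be a b d (Y p) (Z p) <=
                      X q + quad al be a b d (Y q) (Z q)) ->
  let gy := al + 2 * a * Y p + 2 * b * Z p in
  let gz := be + 2 * b * Y p + 2 * d * Z p in
  0 <= (1 + gy ^+ 2 + gz ^+ 2) * (2 * a + 2 * d + gz) -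
       (2 * a * gy ^+ 2 + 4 * b * gy * gz + 2 * d * gz ^+ 2).

(** Reflecting [Y] only flips the signs of [al] and [b]. This lets one barrier argument serve both
    sides of the strip in [min_attained]. *)
Lemma touchingN X Y Z : touching X Y Z -> touching X (fun p => - Y p) Z.
Proof.
move=> T al be a b d p minp /=.
have /(T (- al) be a (- b) d) /= : \forall q \near p,
    X p + quad (- al) be a (- b) d (Y p) (Z p) <=
    X q + quad (- al) be a (- b) d (Y q) (Z q).
  by apply: filterS minp => q; rewrite /quad; lra.
by congr (0 <= _); ring.
Qed.

Lemma continuous_quad X Y Z al be a b d :
    continuous X -> continuous Y -> continuous Z ->
  continuous (fun p => X p + quad al be a b d (Y p) (Z p)).
Proof.
move=> cX cY cZ p; rewrite /quad.
have cc (k : R) : {for p, continuous (fun=> k : R)} by exact: cst_continuous.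
have cM (f g : M -> R) : {for p, continuous f} -> {for p, continuous g} ->
  {for p, continuous (fun q => f q * g q)} by exact: continuousM.
have cD (f g : M -> R) : {for p, continuous f} -> {for p, continuous g} ->
  {for p, continuous (fun q => f q + g q)} by exact: continuousD.
have {}cX := cX p; have {}cY := cY p; have {}cZ := cZ p.
have cY2 : {for p, continuous (fun q => Y q ^+ 2)} by exact: (cM _ _ cY cY).
have cZ2 : {for p, continuous (fun q => Z q ^+ 2)} by exact: (cM _ _ cZ cZ).
apply: (cD _ _ cX); apply: (cD _ _ _ (cM _ _ (cc d) cZ2)).
apply: (cD _ _ _ (cM _ _ (cM _ _ (cc _) cY) cZ)).
by apply: (cD _ _ _ (cM _ _ (cc _) cY2)); apply: cD; exact: cM.
Qed.

(* A line [X = const] is bent slightly, by a parabola concave in [Y], into a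
   strict supersolution that stays below [m] only near [Y = B]. *)
Lemma far_ge_barrier X Y Z (c a B m : R) q0 :
    continuous X -> continuous Y -> continuous Z -> boxes_compact X Y Z ->
    touching X Y Z -> (forall q, c <= X q) ->
    (forall p, exists q, [/\ X q = X p, Y q = Y p & 0 <= Z q <= a]) ->
    (forall q, Y q = B -> m <= X q) -> B < Y q0 ->
  m <= X q0.
Proof.
move=> cX cY cZ bc T Xc per XB BY; rewrite leNgt; apply/negP => Xm.
pose mu := m - c; pose y := Y q0 - B; pose del := m - X q0.
have y0 : 0 < y by rewrite subr_gt0.
have del0 : 0 < del by rewrite subr_gt0.
have delmu : del <= mu by rewrite /del /mu; have := Xc q0; lra.
pose tau := 4 * mu * y / del.
have tauE : tau * del = 4 * mu * y by rewrite /tau; field; lra.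
have tau0 : 0 < tau by rewrite /tau divr_gt0// !mulr_gt0//; lra.
have tauy : y < tau by nra.
pose eta := mu / tau ^+ 2.
have etaE : eta * tau ^+ 2 = mu by rewrite /eta; field; lra.
have eta0 : 0 < eta by rewrite /eta divr_gt0// ?exprn_gt0//; lra.
clearbody tau eta.
pose al := eta * (2 * tau + 2 * B).
pose u p := X p + quad al 0 (- eta) 0 0 (Y p) (Z p).
pose k := - eta * B * (2 * tau + B).
have uE p : u p + k = X p + eta * (Y p - B) * (2 * tau - (Y p - B)).
  by rewrite /u /quad /al /k; ring.
have u0 : u q0 + k < m.
  rewrite uE -/y; suff : eta * y * (2 * tau - y) < del by rewrite /del; lra.
  have : eta * y * (2 * tau) * 2 = del.
    apply: (@mulIf _ tau); first lra.
    by rewrite [RHS]mulrC tauE -etaE; ring.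
  have : 0 < eta * y * y by do ?apply: mulr_gt0.
  have : 0 < eta * y * tau by do ?apply: mulr_gt0.
  lra.
have [q1 [Xq1 Yq1 Zq1]] := per q0.
have uq1 : u q1 = u q0 by rewrite /u /quad Xq1 Yq1; ring.
pose E := [set p | [/\ c <= X p <= m, B <= Y p <= B + tau & 0 <= Z p <= a]].
have cE : compact E by exact: compact_box.
have cu : continuous u by exact: continuous_quad.
have Eq1 : E q1.
  split=> //; first by rewrite Xc Xq1 ltW.
  by rewrite Yq1 ltW//=; move: tauy; rewrite /y; lra.
(* This minimum over [E] is local on all of [M]: the faces [Y = B], [Y = B + tau] and [X = m]
   contradict [u + k < m], the face [X = c] is harmless since [c <= X] everywhere, and [per] brings
   [Z] into [[0, a]] without changing [u]. *)
have [p [/andP[_ Xp] /andP[Bp pB] _] minp] := compact_min cE cu Eq1.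
have up : u p + k < m by have := minp _ Eq1; rewrite uq1; lra.
have Bp' : B < Y p.
  rewrite lt_neqAle Bp andbT; apply/eqP => YB.
  by have := XB _ (esym YB); move: up; rewrite uE -YB; lra.
have pB' : Y p < B + tau.
  rewrite lt_neqAle pB andbT; apply/eqP => YB; move: up.
  rewrite uE YB (_ : eta * _ * _ = mu); last by rewrite -etaE; ring.
  by have := Xc p; rewrite /mu; lra.
have Xp' : X p < m.
  rewrite lt_neqAle Xp andbT; apply/eqP => XE; move: up; rewrite uE XE.
  suff : 0 < eta * (Y p - B) * (2 * tau - (Y p - B)) by lra.
  by do ?apply: mulr_gt0; lra.
have /T /= : \forall q \near p, u p <= u q.
  have cc (r : R) : continuous (fun _ : M => r : R).
    by move=> ?; exact: cst_continuous.
  near=> q.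
  have [q' [Xq' Yq' Zq']] := per q.
  have -> : u q = u q' by rewrite /u /quad Xq' Yq'; ring.
  apply: minp; split => //.
    by rewrite Xc Xq' ltW//; near: q; exact: near_lt_cts.
  rewrite Yq' !ltW//; near: q; exact: near_lt_cts.
(* The test function does not involve [Z], so the touching quantity collapses to the second
   derivative of the parabola. *)
set s := al + _ + _; set e := (X in 0 <= X).
suff -> : e = - 2 * eta by lra.
by rewrite /e; ring.
Unshelve. all: by end_near. Qed.

(** Periodicity reduces the strip [|Y| <= B], chosen to contain [q0], to a compact box. Beyond the
    strip, [far_ge_barrier] applies from [Y = B], and after a reflection from [Y = - B]. *)
Lemma min_attained X Y Z (c a : R) (q0 : M) :
    continuous X -> continuous Y -> continuous Z -> boxes_compact X Y Z ->
    touching X Y Z -> (forall q, c <= X q) ->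
    (forall p, exists q, [/\ X q = X p, Y q = Y p & 0 <= Z q <= a]) ->
  exists p0, forall q, X p0 <= X q.
Proof.
move=> cX cY cZ bc T Xc per; pose B := `|Y q0|.
pose E := [set p | [/\ c <= X p <= X q0, - B <= Y p <= B & 0 <= Z p <= a]].
have cE : compact E by exact: compact_box.
have YB p : (- B <= Y p <= B) = (`|Y p| <= B) by rewrite ler_norml.
have [q1 [Xq1 Yq1 Zq1]] := per q0.
have Eq1 : E q1 by split; rewrite ?Xc ?Xq1 ?YB ?Yq1//=.
have [p0 Ep0 minp0] := compact_min cE cX Eq1.
exists p0; have strip q : `|Y q| <= B -> X p0 <= X q.
  move=> Yq; have [Xq|/ltW Xq] := leP (X q) (X q0); last first.
    by rewrite (le_trans _ Xq)// -Xq1 minp0.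
  have [q' [Xq' Yq' Zq']] := per q; rewrite -Xq'; apply: minp0.
  by split; rewrite ?Xc ?Xq' ?YB ?Yq'.
move=> q; have [/strip//|BY] := leP `|Y q| B.
have B0 : 0 <= B by exact: normr_ge0.
move: BY; rewrite lter_normr => /orP[BY|BY].
  apply: (far_ge_barrier cX cY cZ bc T Xc per _ BY) => q' Yq'.
  by apply: strip; rewrite Yq' ger0_norm.
apply: (far_ge_barrier (a := a) cX _ cZ (boxes_compactN bc) (touchingN T)
  Xc _ _ BY).
- by move=> p; apply: continuousN; exact: cY.
- by move=> p; have [q' [? Yq' ?]] := per p; exists q'; split; rewrite /= ?Yq'.
- by move=> q' /= Yq'; apply: strip; rewrite -normrN Yq' ger0_norm.
Qed.

End Touching.

(** * The Hopf barrier *)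

Section Hopf.
Context {R : realType} {M : topologicalType}.
Implicit Types (X Y Z : M -> R).

Lemma continuous_affine Y Z (a b y0 z0 : R) : continuous Y -> continuous Z ->
  continuous (fun p => a * (Y p - y0) + b * (Z p - z0)).
Proof.
move=> cY cZ p.
have cc (k : R) : {for p, continuous (fun=> k : R)} by exact: cst_continuous.
have cl f (k r : R) : continuous f ->
    {for p, continuous (fun q => k * (f q - r))}.
  by move=> cf; apply: (continuousM (cc k)); apply: (continuousB (cf p) (cc r)).
by apply: (continuousD (cl _ _ _ cY) (cl _ _ _ cZ)).
Qed.

(* At a point with inner normal coordinate [t] and tangential coordinate [s]
   (both scaled by the radius [sqrt N]), the parabolic region is inside the
   disc. *)
Lemma parabola_in_disc (N C K t s tau : R) :
    0 < N -> C * N = 1 -> 0 < K -> tau * (1 + K * N) < N -> - tau <= t <= tau ->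
    0 <= t + K * t ^+ 2 - C * s ^+ 2 -> 2 * N * t <= t ^+ 2 + s ^+ 2 ->
  t = 0 /\ s = 0.
Proof.
move=> N0 CN K0 tauN /andP[tl tr] q0 out.
have q0' : s ^+ 2 <= N * t + K * N * t ^+ 2.
  have := mulr_ge0 (ltW N0) q0.
  have -> : N * (t + K * t ^+ 2 - C * s ^+ 2) =
    N * t + K * N * t ^+ 2 - C * N * s ^+ 2 by ring.
  by rewrite CN; lra.
(* For [t > 0] the bound [q0'] gives [t ^+ 2 + s ^+ 2 <= t * (N + t * (1 + K * N)) < 2 * N * t],
   against the last hypothesis. *)
have t0 : t <= 0.
  rewrite leNgt; apply/negP => t0.
  have h : t * (1 + K * N) < N.
    by apply: le_lt_trans tauN; rewrite ler_pM2r//; nra.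
  by have := mulr_gt0 t0 (_ : 0 < N - t * (1 + K * N)); rewrite subr_gt0; nra.
have Kt : 0 < 1 + K * t.
  have : K * tau < 1 by nra.
  by nra.
have tE : t = 0.
  apply/eqP; rewrite eq_le t0/=; rewrite -(pmulr_rge0 _ Kt).
  by rewrite -(pmulr_rge0 _ N0); have := sqr_ge0 s; nra.
split=> //; apply/eqP; rewrite -sqrf_eq0; move: q0'; rewrite tE.
by have := sqr_ge0 s; move: (s ^+ 2) => x ? ?; apply/eqP; lra.
Qed.

Lemma norm_lt_sqr_sum (a b r : R) : 0 < r -> a ^+ 2 + b ^+ 2 < r ^+ 2 ->
  `|a| < r /\ `|b| < r.
Proof.
move=> r0; have := sqr_ge0 a; have := sqr_ge0 b => a0 b0 ab.
by split; rewrite ltr_norml; apply/andP; split; nra.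
Qed.

(* [(gy, gz)] and [a, b, d] are the gradient and the Hessian coefficients of
   [- ep (t + K t^2 - C s^2)], for [t = d2 y + d3 z], [s = - d3 y + d2 z]. *)
Lemma hopf_barrier_negative (N C K tau ep t s d2 d3 : R) :
    0 < N -> C * N = 1 -> K * N = 4 + 5 / 2 * N -> N = d2 ^+ 2 + d3 ^+ 2 ->
    2 * (K * tau) < 1 -> 2 * tau < N -> 0 < ep ->
    ep ^+ 2 * (8 * (K * N ^+ 2)) < 1 -> `|t| < tau -> `|s| < tau ->
  let P := 1 + 2 * K * t in let W := 2 * C * s in
  let gy := - ep * (P * d2 + W * d3) in let gz := - ep * (P * d3 - W * d2) in
  let a := - ep * (K * d2 ^+ 2 - C * d3 ^+ 2) in
  let b := - ep * (K + C) * d2 * d3 in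
  let d := - ep * (K * d3 ^+ 2 - C * d2 ^+ 2) in
  (1 + gy ^+ 2 + gz ^+ 2) * (2 * a + 2 * d + gz) -
  (2 * a * gy ^+ 2 + 4 * b * gy * gz + 2 * d * gz ^+ 2) < 0.
Proof.
move=> N0 CN KN NE Ktau tauN ep0 epK /ltr_normlP[t1 t2] /ltr_normlP[s1 s2] /=.
set P := 1 + 2 * K * t; set W := 2 * C * s.
have C0 : 0 < C by rewrite -(pmulr_lgt0 _ N0) CN.
have K0 : 0 < K by rewrite -(pmulr_lgt0 _ N0) KN; lra.
have [P1 P2] : 0 < P /\ P < 2.
  have h1 : K * t < K * tau by rewrite ltr_pM2l.
  have h2 : K * - tau < K * t by rewrite ltr_pM2l//; lra.
  by clear - h1 h2 Ktau; rewrite /P; split; lra.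
have [W1 W2] : - 1 < W /\ W < 1.
  have h1 : C * s < C * tau by rewrite ltr_pM2l.
  have h2 : C * - tau < C * s by rewrite ltr_pM2l//; lra.
  have h3 : C * (2 * tau) < C * N by rewrite ltr_pM2l.
  by clear - h1 h2 h3 CN; rewrite /W; split; lra.
clearbody P W; clear t s t1 t2 s1 s2 tau Ktau tauN.
have P4 : P ^+ 2 <= 4 by clear - P1 P2; nra.
pose J := 2 * (K * N - C * N) + (P * d3 - W * d2).
set e := (X in X < 0).
(* Here [- ep * J] is [tr H + d_z] of the test function and the last summand is [- H(G, G)], of
   order [ep ^+ 3]; so [J >= 1] decides the sign once [ep] is small. *)
have -> : e = - ep * J * (1 + ep ^+ 2 * N * (P ^+ 2 + W ^+ 2)) +
   ep * (ep ^+ 2 * (2 * K * N ^+ 2 * P ^+ 2 - 2 * C * N ^+ 2 * W ^+ 2)).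
  by rewrite /e /J NE; ring.
clear e.
(* The value of [K * N] gives [J >= 6 + 5 * N - (P ^+ 2 + W ^+ 2 + N) / 2]. *)
have J1 : 1 <= J.
  have W4 : W ^+ 2 <= 1 by clear - W1 W2; nra.
  rewrite /J KN CN; have := sqr_ge0 (P + d3); have := sqr_ge0 (W - d2).
  by clear - W4 P4 NE N0; lra.
clearbody J; set S := ep ^+ 2 * N * (P ^+ 2 + W ^+ 2).
have S0 : 0 <= S.
  apply: mulr_ge0; last by apply: addr_ge0; exact: sqr_ge0.
  by apply: mulr_ge0; [exact: sqr_ge0|exact: ltW].
have e1 : ep * (1 + S) * 1 <= ep * (1 + S) * J.
  by rewrite ler_pM2l// mulr_gt0// ltr_pwDl.
have e2 : ep * (ep ^+ 2 * (2 * K * N ^+ 2 * P ^+ 2)) < ep.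
  rewrite gtr_pMr//; apply: le_lt_trans epK; rewrite ler_pM2l ?exprn_gt0//.
  have -> : 2 * K * N ^+ 2 * P ^+ 2 = K * N ^+ 2 * (2 * P ^+ 2) by ring.
  have -> : 8 * (K * N ^+ 2) = K * N ^+ 2 * 8 by ring.
  rewrite ler_pM2l; first by clear - P4; lra.
  by rewrite mulr_gt0// exprn_gt0.
have e3 : 0 <= ep * (ep ^+ 2 * (C * N ^+ 2 * W ^+ 2)).
  by do ?[exact: sqr_ge0|exact: ltW|apply: mulr_ge0].
have e4 : 0 <= ep * S by apply: mulr_ge0 S0; exact: ltW.
by clearbody S; clear - e1 e2 e3 e4; move: (ep ^+ 2) e1 e2 e3 e4 => ee; lra.
Qed.

(** Otherwise the open disc about [(y, z)] through the projection of [p0] contains no contact point.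
    Subtracting from [X] a small multiple of a Hopf barrier vanishing at [p0] then produces a local
    minimum that [touching] forbids. The pair [Do], [D] covers both a large box and a single small
    sheet. *)
Lemma hopf_contact X Y Z (D Do : set M) (m y z sg : R) p0 :
    continuous X -> continuous Y -> continuous Z -> touching X Y Z ->
    compact D -> open Do -> Do `<=` D -> (forall p, D p -> m <= X p) ->
    D p0 -> X p0 = m -> 0 < sg ->
    (forall p, D p -> X p < m + 1 -> `|Y p - Y p0| < sg ->
       `|Z p - Z p0| < sg -> Do p) ->
    0 < (y - Y p0) ^+ 2 + (z - Z p0) ^+ 2 ->
  exists p, [/\ D p, X p = m & (y - Y p) ^+ 2 + (z - Z p) ^+ 2 <
                               (y - Y p0) ^+ 2 + (z - Z p0) ^+ 2].
Proof.
move=> cX cY cZ T cD oDo DoD Xm Dp0 Xp0 sg0 nearDo.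
set N := _ + _ => N0; apply: contrapT => disc.
have {}disc p : D p -> X p = m -> N <= (y - Y p) ^+ 2 + (z - Z p) ^+ 2.
  by move=> Dp Xp; rewrite leNgt; apply/negP => ?; apply: disc; exists p.
pose d2 := y - Y p0; pose d3 := z - Z p0.
have NE : N = d2 ^+ 2 + d3 ^+ 2 by [].
pose t p := d2 * (Y p - Y p0) + d3 * (Z p - Z p0).
pose s p := - d3 * (Y p - Y p0) + d2 * (Z p - Z p0).
have ct : continuous t by exact: continuous_affine.
have cs : continuous s by exact: continuous_affine.
have tsE p : t p ^+ 2 + s p ^+ 2 = N * ((Y p - Y p0) ^+ 2 + (Z p - Z p0) ^+ 2).
  by rewrite NE /t /s; ring.
have yzE p : (y - Y p) ^+ 2 + (z - Z p) ^+ 2 =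
    (Y p - Y p0) ^+ 2 + (Z p - Z p0) ^+ 2 - 2 * t p + N.
  by rewrite NE /t /d2 /d3; ring.
clearbody N.
pose C := N^-1.
have CN : C * N = 1 by rewrite /C mulVf// gt_eqF.
have C0 : 0 < C by rewrite invr_gt0.
(* [K] makes [tr H + d_z] of the barrier [t + K t^2 - C s^2] at least [1], and
   [tau] is so small that the region where the barrier is nonnegative stays in
   the disc and projects to within [sg] of the contact point. *)
pose K := (8 + 5 * N) / (2 * N).
have KN : K * N = 4 + 5 / 2 * N by rewrite /K; field; rewrite gt_eqF.
have K0 : 0 < K by rewrite divr_gt0//; lra.
pose ka := (2 * (1 + K * N) + (1 + 2 * N) / sg)^-1.
have kaE : ka * (2 * (1 + K * N)) + ka * ((1 + 2 * N) / sg) = 1.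
  rewrite -mulrDr /ka mulVf// gt_eqF// addr_gt0// ?divr_gt0//; last lra.
  by rewrite mulr_gt0// KN; lra.
have ka0 : 0 < ka.
  rewrite /ka invr_gt0 addr_gt0// ?divr_gt0//; last lra.
  by rewrite mulr_gt0// KN; lra.
have ka1 : ka * (2 * (1 + K * N)) < 1.
  by rewrite -[ltRHS]kaE ltrDl mulr_gt0// divr_gt0//; lra.
have ka2 : ka * (1 + 2 * N) < sg.
  have : ka * ((1 + 2 * N) / sg) < 1.
    by rewrite -[ltRHS]kaE ltrDr mulr_gt0// mulr_gt0//; lra.
  by rewrite mulrA ltr_pdivrMr// mul1r.
clearbody ka.
pose tau := N * ka.
have tau0 : 0 < tau by rewrite mulr_gt0.
have tauN : 2 * tau * (1 + K * N) < N.
  have := mulr_gt0 N0 (_ : 0 < 1 - ka * (2 * (1 + K * N))).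
  by rewrite subr_gt0 => /(_ ka1); rewrite /tau; lra.
have Ktau : 2 * (K * tau) < 1 by rewrite -(ltr_pM2r N0); lra.
have tauN1 : 2 * tau < N.
  by have := mulr_gt0 tau0 (mulr_gt0 K0 N0); lra.
have tausg : 2 * tau ^+ 2 < N * sg ^+ 2.
  have sq : (ka * (1 + 2 * N)) ^+ 2 < sg ^+ 2.
    by rewrite ltr_pXn2r// nnegrE ltW// mulr_gt0//; lra.
  have -> : 2 * tau ^+ 2 = N * (2 * N * ka ^+ 2) by rewrite /tau; ring.
  rewrite ltr_pM2l//; apply: le_lt_trans sq; rewrite exprMn mulrC.
  by rewrite ler_pM2l ?exprn_gt0//; nra.
clearbody tau.
pose q p := t p + K * t p ^+ 2 - C * s p ^+ 2.
pose E := D `&` [set p | [/\ m <= X p <= m + 1, - tau <= t p <= tau &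
  - tau <= s p <= tau]].
have cE : compact E by apply: (compact_closedI cD); exact: closed_box.
have qE p : q p = (t p + K * t p ^+ 2 - C * s p ^+ 2) by [].
have cq : continuous q.
  rewrite (_ : q = fun p => t p + quad 0 0 K 0 (- C) (t p) (s p)).
    exact: continuous_quad.
  by apply: funext => p; rewrite /quad /q; ring.
(* By [parabola_in_disc], a contact point of [E] with [0 <= q] has [t = s = 0]; so [X > m] on this
   compact set, and its minimum there gives the gap. *)
have [del del0 Xdel] : exists2 del, 0 < del & forall p, E p -> 0 <= q p ->
    tau ^+ 2 <= t p ^+ 2 + s p ^+ 2 -> m + del <= X p.
  pose E2 := E `&` ([set p | 0 <= q p] `&`
    [set p | tau ^+ 2 <= t p ^+ 2 + s p ^+ 2]).
  have cE2 : compact E2.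
    apply: (compact_closedI cE); apply: closedI.
      by apply: closed_le_cts => // p; exact: cst_continuous.
    apply: closed_le_cts; first by move=> p; exact: cst_continuous.
    move=> p.
    exact: (continuousD (continuousM (ct p) (ct p))
                        (continuousM (cs p) (cs p))).
  have [[p1 E2p1]|E20] := pselect (exists p, E2 p); last first.
    by exists 1 => // p Ep qp tsp; exfalso; apply: E20; exists p.
  have [p2 [[Dp2 [/andP[Xp2 _] tp2 _]] [q2 ts2]] minp2] :=
    compact_min cE2 cX E2p1.
  exists (X p2 - m); last first.
    by move=> p Ep qp tsp; rewrite addrC subrK; apply: minp2.
  rewrite subr_gt0 lt_neqAle Xp2 andbT; apply/eqP => /esym Xm2.
  have := disc _ Dp2 Xm2; rewrite yzE => out.
  have out' : 2 * N * t p2 <= t p2 ^+ 2 + s p2 ^+ 2 by rewrite tsE; nra.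
  have [|t0 s0] := parabola_in_disc N0 CN K0 _ tp2 q2 out'; first nra.
  by move: ts2; rewrite /= t0 s0 => ts2; have := exprn_gt0 2 tau0; lra.
pose Q := tau + K * tau ^+ 2.
have Q0 : 0 < Q by rewrite addr_gt0// mulr_gt0// exprn_gt0.
have qQ p : E p -> q p <= Q.
  move=> [_ [_ /andP[tl tr] _]]; rewrite /q /Q.
  have : 0 <= C * s p ^+ 2 by rewrite mulr_ge0// ?sqr_ge0// ltW.
  have : K * t p ^+ 2 <= K * tau ^+ 2 by rewrite ler_pM2l//; nra.
  lra.
(* Each summand yields one smallness condition: [ep < 1], [ep * Q < del], [ep * Q < 1], and the
   bound required by [hopf_barrier_negative]. *)
pose ep := (1 + Q / del + Q + 8 * (K * N ^+ 2))^-1.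
have KN2 : 0 < K * N ^+ 2 by apply: mulr_gt0; rewrite ?exprn_gt0.
have Qdel : 0 < Q / del by apply: divr_gt0.
clearbody Q.
have epE : ep * (1 + Q / del + Q + 8 * (K * N ^+ 2)) = 1.
  by rewrite /ep mulVf// gt_eqF//; lra.
have ep0 : 0 < ep by rewrite /ep invr_gt0; lra.
clearbody ep.
have epQd : 0 < ep * (Q / del) by rewrite mulr_gt0.
have epQ : 0 < ep * Q by rewrite mulr_gt0.
have epKN : 0 < ep * (K * N ^+ 2) by rewrite mulr_gt0.
have ep1 : ep * Q < 1 by lra.
have ep2 : ep * Q < del.
  have : ep * (Q / del) < 1 by lra.
  by rewrite mulrA ltr_pdivrMr// mul1r.
have ep3 : ep ^+ 2 * (8 * (K * N ^+ 2)) < 1.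
  by have : ep < 1 by [lra]; nra.
pose u p := X p - ep * q p.
have cu : continuous u.
  move=> p; apply: (continuousB (cX p)).
  exact: (continuousM (@cst_continuous _ _ ep p) (cq p)).
have tp0 : t p0 = 0 by rewrite /t; ring.
have sp0 : s p0 = 0 by rewrite /s; ring.
have Ep0 : E p0.
  have tau0' : - tau <= 0 <= tau by rewrite oppr_le0 ltW.
  by split=> //; rewrite /= tp0 sp0 Xp0; split=> //; rewrite lexx lerDl ler01.
have [p Ep minp] := compact_min cE cu Ep0.
have up : X p - ep * q p <= m.
  have := minp _ Ep0.
  by rewrite /u (qE p0) tp0 sp0 Xp0 expr0n /= !mulr0 addr0 subr0 mulr0 subr0.
have [Dp [/andP[mX Xm1] tp sp]] := Ep.
have epq : ep * q p <= ep * Q by rewrite ler_pM2l// qQ.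
(* Away from [p0] the value of [u] exceeds [m]: where [0 <= q] the gap [del] beats [ep * Q], and
   where [q < 0] the barrier term is positive. *)
have tsp : t p ^+ 2 + s p ^+ 2 < tau ^+ 2.
  rewrite ltNge; apply/negP => ts; have [q0|q0] := leP 0 (q p).
    have Xd := Xdel _ Ep q0 ts.
    by clear - Xd up epq ep2; lra.
  have epq0 : 0 < ep * - q p by rewrite mulr_gt0// oppr_gt0.
  by clear - up epq0 mX; lra.
have Xp : X p < m + 1.
  rewrite lt_neqAle Xm1 andbT; apply/eqP => XE; move: up; rewrite XE => up'.
  by clear - up' epq ep1; lra.
have [tp1 sp1] := norm_lt_sqr_sum tau0 tsp.
have Dop : Do p.
  have YZ : (Y p - Y p0) ^+ 2 + (Z p - Z p0) ^+ 2 < sg ^+ 2.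
    rewrite -(ltr_pM2l N0) -tsE; have tau2 := sqr_ge0 tau.
    by clear - tsp tausg tau2; lra.
  by have [? ?] := norm_lt_sqr_sum sg0 YZ; exact: nearDo.
(* Expansion of [- ep * q] in powers of [Y] and [Z]; [k] is the constant term, which [quad] does not
   carry. *)
pose t0 := d2 * Y p0 + d3 * Z p0.
pose s0 := - d3 * Y p0 + d2 * Z p0.
pose al := - ep * (d2 - 2 * K * t0 * d2 - 2 * C * d3 * s0).
pose be := - ep * (d3 - 2 * K * t0 * d3 + 2 * C * d2 * s0).
pose a := - ep * (K * d2 ^+ 2 - C * d3 ^+ 2).
pose b := - ep * (K + C) * d2 * d3.
pose d := - ep * (K * d3 ^+ 2 - C * d2 ^+ 2).
pose k := - ep * (- t0 + K * t0 ^+ 2 - C * s0 ^+ 2).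
have uE q' : X q' + quad al be a b d (Y q') (Z q') = u q' - k.
  by rewrite /u /quad /q /t /s /al /be /a /b /d /k /t0 /s0; ring.
have minu : \forall q' \near p, X p + quad al be a b d (Y p) (Z p) <=
                                 X q' + quad al be a b d (Y q') (Z q').
  have cc (r : R) : continuous (fun _ : M => r : R).
    by move=> ?; exact: cst_continuous.
  have cabs (f : M -> R) : continuous f -> continuous (fun q' => `|f q'|).
    by move=> cf q'; exact: (cvg_norm (cf q')).
  near=> q'; rewrite !uE lerD2r; apply: minp.
  have Dq' : Do q' by near: q'; exact: open_nbhs_nbhs.
  split; first exact: DoD.
  have Xq' : X q' < m + 1 by near: q'; exact: near_lt_cts.
  have tq' : `|t q'| < tau.
    by near: q'; exact: (near_lt_cts (cabs _ ct) (cc tau) tp1).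
  have sq' : `|s q'| < tau.
    by near: q'; exact: (near_lt_cts (cabs _ cs) (cc tau) sp1).
  split; [|by rewrite -ler_norml ltW|by rewrite -ler_norml ltW].
  by rewrite (Xm _ (DoD _ Dq')) ltW.
have /= := T _ _ _ _ _ _ minu; apply/negP; rewrite -ltNge.
have -> : al + 2 * a * Y p + 2 * b * Z p =
    - ep * ((1 + 2 * K * t p) * d2 + 2 * C * s p * d3).
  by rewrite /al /a /b /t /s /t0 /s0; ring.
have -> : be + 2 * b * Y p + 2 * d * Z p =
    - ep * ((1 + 2 * K * t p) * d3 - 2 * C * s p * d2).
  by rewrite /be /b /d /t /s /t0 /s0; ring.
exact: (hopf_barrier_negative N0 CN KN NE Ktau tauN1 ep0 ep3 tp1 sp1).
Unshelve. all: by end_near. Qed.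

End Hopf.

(** * The set where the minimum of [X] is attained *)

Section Planarity.
Context {R : realType} {M : topologicalType}.
Implicit Types (X Y Z : M -> R).

Lemma continuous_dist2 Y Z (y z : R) : continuous Y -> continuous Z ->
  continuous (fun p => (y - Y p) ^+ 2 + (z - Z p) ^+ 2).
Proof.
move=> cY cZ p.
have cB f (k : R) : continuous f -> {for p, continuous (fun q : M => k - f q)}.
  by move=> cf; exact: (continuousB (@cst_continuous _ _ k p) (cf p)).
have cY' := cB _ y cY; have cZ' := cB _ z cZ.
exact: (continuousD (continuousM cY' cY') (continuousM cZ' cZ')).
Qed.

Lemma open_lt_cts (f g : M -> R) : continuous f -> continuous g ->
  open [set p | f p < g p].
Proof.
move=> cf cg; rewrite openE => p fg; exact: near_lt_cts.
Qed.

(** Compactness provides a contact point whose projection is nearest to [(y, z)]; at positive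
    distance [hopf_contact] would give a nearer one. The factor [3] adds the steps from [p0] to
    [(y, z)], on to the nearest point, and to its [r]-neighbourhood. *)
Lemma contact_disc X Y Z (D Do : set M) (m r y z : R) p0 :
    continuous X -> continuous Y -> continuous Z -> touching X Y Z ->
    compact D -> open Do -> Do `<=` D -> (forall p, D p -> m <= X p) ->
    D p0 -> X p0 = m -> 0 < r ->
    (forall p, D p -> X p < m + 1 -> `|Y p - Y p0| < 3 * r ->
       `|Z p - Z p0| < 3 * r -> Do p) ->
    (y - Y p0) ^+ 2 + (z - Z p0) ^+ 2 < r ^+ 2 ->
  exists p, [/\ D p, X p = m, Y p = y & Z p = z].
Proof.
move=> cX cY cZ T cD oDo DoD Xm Dp0 Xp0 r0 nearDo yz.
pose E := D `&` [set p | X p <= m].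
have cE : compact E.
  apply: (compact_closedI cD); apply: closed_le_cts => // p.
  exact: cst_continuous.
have Ep0 : E p0 by split=> //=; rewrite Xp0.
have [p1 [Dp1 Xp1] minp1] :=
  compact_min cE (@continuous_dist2 Y Z y z cY cZ) Ep0.
have {}Xp1 : X p1 = m by apply/eqP; rewrite eq_le Xp1 Xm.
have yz1 := minp1 _ Ep0.
have [Y2 Z2] : 0 <= (y - Y p1) ^+ 2 /\ 0 <= (z - Z p1) ^+ 2.
  by split; exact: sqr_ge0.
have [N0|N0] := leP ((y - Y p1) ^+ 2 + (z - Z p1) ^+ 2) 0.
  exists p1; split=> //; apply/esym/eqP; rewrite -subr_eq0 -sqrf_eq0; apply/eqP;
    lra.
have [|p [Dp Xp]] := hopf_contact cX cY cZ T cD oDo DoD Xm Dp1 Xp1 r0 _ N0.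
  have [/ltr_normlP[? ?] /ltr_normlP[? ?]] := norm_lt_sqr_sum r0 yz.
  have [/ltr_normlP[? ?] /ltr_normlP[? ?]] :=
    norm_lt_sqr_sum r0 (le_lt_trans yz1 yz).
  move=> p Dp Xp /ltr_normlP[? ?] /ltr_normlP[? ?].
  by apply: nearDo => //; apply/ltr_normlP; split; lra.
by rewrite ltNge minp1//; split=> //=; rewrite Xp.
Qed.

(** The disc may be as large as desired: [D] is a compact box around [p0], and [r] exceeds the
    distance from the projection of [p0] to [(y, z)]. *)
Lemma contact_plane X Y Z p0 (y z : R) :
    continuous X -> continuous Y -> continuous Z -> boxes_compact X Y Z ->
    touching X Y Z -> (forall p, X p0 <= X p) ->
  exists p, [/\ X p = X p0, Y p = y & Z p = z].
Proof.
move=> cX cY cZ bc T minp0.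
pose r := `|y - Y p0| + `|z - Z p0| + 1.
have [ay az] : 0 <= `|y - Y p0| /\ 0 <= `|z - Z p0| by split; exact: normr_ge0.
have r1 : 1 <= r by rewrite /r; lra.
pose D := [set p | [/\ X p0 <= X p <= X p0 + 1,
  Y p0 - 3 * r <= Y p <= Y p0 + 3 * r & Z p0 - 3 * r <= Z p <= Z p0 + 3 * r]].
pose Do := [set p | X p < X p0 + 1] `&`
  ([set p | Y p0 - 3 * r < Y p] `&` ([set p | Y p < Y p0 + 3 * r] `&`
  ([set p | Z p0 - 3 * r < Z p] `&` [set p | Z p < Z p0 + 3 * r]))).
have oDo : open Do.
  do ?[apply: openI]; apply: open_lt_cts => // p; exact: cst_continuous.
have [|||||||||p [_ ? ? ?]] :=
  @contact_disc X Y Z D Do (X p0) r y z p0 cX cY cZ T.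
- exact: compact_box.
- exact: oDo.
- move=> p [/= ? [? [? [? ?]]]]; split; apply/andP; split=> //; exact: ltW.
- by move=> p [/andP[]].
- by split; apply/andP; split; lra.
- by [].
- lra.
- by move=> p _ Xp /ltr_normlP[? ?] /ltr_normlP[? ?]; do ?split => //=; lra.
- rewrite -[X in X ^+ 2 + _]/(y - Y p0) -(real_normK (num_real (y - Y p0))).
  by rewrite -(real_normK (num_real (z - Z p0))) /r; nra.
by exists p.
Qed.

(* Stated with a compact [D] so that injectivity survives on the boundary. *)
Definition locally_injective_at Y Z p := exists D Do : set M,
  [/\ compact D, open Do, Do p, Do `<=` D &
     forall q q', D q -> D q' -> Y q = Y q' -> Z q = Z q' -> q = q'].

Lemma near_contact X Y Z p0 :
    continuous X -> continuous Y -> continuous Z -> touching X Y Z ->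
    (forall p, X p0 <= X p) -> locally_injective_at Y Z p0 ->
  \forall q \near p0, X q = X p0.
Proof.
move=> cX cY cZ T minp0 [D [Do [cD oDo Dop0 DoD inj]]].
pose dist2 p := (Y p0 - Y p) ^+ 2 + (Z p0 - Z p) ^+ 2.
have cd : continuous dist2 by exact: continuous_dist2.
have [del del0 farDo] : exists2 del, 0 < del &
    forall p, D p -> ~ Do p -> del <= dist2 p.
  have cE : compact (D `&` ~` Do).
    by apply: (compact_closedI cD); exact: open_closedC.
  have [[p1 Ep1]|E0] := pselect (exists p, (D `&` ~` Do) p); last first.
    by exists 1 => // p Dp Dop; exfalso; apply: E0; exists p.
  have [p2 [Dp2 Dop2] minp2] := compact_min cE cd Ep1.
  exists (dist2 p2) => [|p Dp Dop]; last exact: minp2.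
  rewrite lt_neqAle addr_ge0 ?sqr_ge0// andbT; apply/eqP => d0.
  apply: Dop2; rewrite -(inj p0 p2) //; first exact: DoD.
    apply/eqP; rewrite -subr_eq0 -sqrf_eq0; apply/eqP.
    have := sqr_ge0 (Y p0 - Y p2); have := sqr_ge0 (Z p0 - Z p2).
    by move: d0; rewrite /dist2; lra.
  apply/eqP; rewrite -subr_eq0 -sqrf_eq0; apply/eqP.
  have := sqr_ge0 (Y p0 - Y p2); have := sqr_ge0 (Z p0 - Z p2).
  by move: d0; rewrite /dist2; lra.
(* Points with both coordinates within [3 * r] have [dist2 <= 18 * r ^+ 2 < del], hence avoid the
   part of [D] outside [Do]. *)
pose r := del / (18 + del).
have rE : r * (18 + del) = del by rewrite /r divfK// gt_eqF//; lra.
have r0 : 0 < r by rewrite divr_gt0//; lra.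
clearbody r.
have r1 : r < 1 by nra.
have r2 : 18 * r ^+ 2 < del by nra.
near=> q.
have Doq : Do q by near: q; exact: open_nbhs_nbhs.
have dq : dist2 q < r ^+ 2.
  near: q; apply: near_lt_cts => //; first by move=> ?; exact: cst_continuous.
  by rewrite /dist2 !subrr expr0n/= addr0 exprn_gt0.
have [||p [Dp Xp Yp Zp]] := @contact_disc X Y Z D Do (X p0) r (Y q) (Z q) p0
    cX cY cZ T cD oDo DoD (fun p _ => minp0 p) (DoD _ Dop0) erefl r0.
- move=> p Dp _ /ltr_normlP[Y1 Y2] /ltr_normlP[Z1 Z2].
  apply: contrapT => /(farDo _ Dp); rewrite /dist2.
  have : (Y p0 - Y p) ^+ 2 <= 9 * r ^+ 2 by nra.
  have : (Z p0 - Z p) ^+ 2 <= 9 * r ^+ 2 by nra.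
  lra.
- by move: dq; rewrite /dist2; lra.
by rewrite -Xp (inj p q)//; exact: DoD.
Unshelve. all: by end_near. Qed.

Lemma touching_plane X Y Z (c a : R) (q0 : M) :
    connected [set: M] ->
    continuous X -> continuous Y -> continuous Z -> boxes_compact X Y Z ->
    touching X Y Z ->
    (forall p, (forall q, X p <= X q) -> locally_injective_at Y Z p) ->
    (forall q, c <= X q) ->
    (forall p, exists q, [/\ X q = X p, Y q = Y p & 0 <= Z q <= a]) ->
  exists m, (forall p, X p = m) /\
            forall y z, exists p, Y p = y /\ Z p = z.
Proof.
move=> conM cX cY cZ bc T inj Xc per.
have [p0 minp0] := min_attained q0 cX cY cZ bc T Xc per.
exists (X p0); split; last first.
  move=> y z; have [p [_ ? ?]] := contact_plane y z cX cY cZ bc T minp0.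
  by exists p.
pose B := [set p | X p = X p0].
have BE : B = [set p | X p <= X p0].
  apply/seteqP; split=> p /=; first by move=> ->.
  by move=> Xp; apply/eqP; rewrite eq_le Xp minp0.
suff BT : B = [set: M] by move=> p; have : B p by rewrite BT.
apply: conM.
- by exists p0.
- exists B; last by rewrite setTI.
  rewrite openE => p Xp; rewrite /B /interior -Xp.
  have minp q : X p <= X q by rewrite Xp.
  exact: (near_contact cX cY cZ T minp (inj _ minp)).
- exists B; last by rewrite setTI.
  by rewrite BE; apply: closed_le_cts => // p; exact: cst_continuous.
Qed.

End Planarity.

(** * Second derivative test and mean value theorem along a direction *)

Section Calculus.
Context {R : realType} {V : normedModType R}.
Implicit Types (f df : V -> R) (x v : V).

Lemma is_derive_line f x v (t d : R) :
  is_derive (x + t *: v) v f d ->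
  is_derive t (1 : R) (fun s : R => f (x + s *: v) : R^o) d.
Proof.
move=> [fd fE].
have lineE : (fun h : R => h^-1 *: ((f \o shift (x + t *: v)) (h *: v) -
                                    f (x + t *: v))) =
    (fun h : R => h^-1 *:
      (((fun s : R => f (x + s *: v) : R^o) \o shift t) (h *: 1) -
       f (x + t *: v))).
  apply: funext => h /=; congr (_ *: (f _ - _)).
  by rewrite [h *: 1]mulr1 scalerDl addrCA.
split; first by move: fd; rewrite /derivable lineE.
by rewrite -fE /derive lineE.
Qed.

Lemma line_near (P : V -> Prop) x v : (\forall y \near x, P y) ->
  exists2 e : R, 0 < e & forall t : R, `|t| < e -> P (x + t *: v).
Proof.
move=> Px.
have cl : (fun t : R => x + t *: v) @ (0 : R) --> x.
  rewrite -[X in _ --> X]addr0 -(scale0r v); apply: cvgD; first exact: cvg_cst.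
  by apply: cvgZr_tmp; exact: cvg_id.
have /nbhs_ballP[e /= e0 Pe] : nbhs (0 : R) [set t : R | P (x + t *: v)].
  exact: cl _ Px.
by exists e => // t te; apply: Pe; rewrite /ball /= sub0r normrN.
Qed.

(** If [d2 < 0], the derivative along the line is negative just after [x], and the mean value
    theorem yields a value smaller than [f x]. *)
Lemma second_derivative_test f df x v (d2 : R) :
    (\forall y \near x, is_derive y v f (df y)) -> is_derive x v df d2 ->
    (\forall y \near x, f x <= f y) ->
  df x = 0 /\ 0 <= d2.
Proof.
move=> fdf dfd2 minx.
have [e e0 H] := line_near v (filterI fdf minx).
pose phi t := f (x + t *: v); pose dphi t := df (x + t *: v).
have phid (t : R) : `|t| < e -> is_derive t (1 : R) (phi : R -> R^o) (dphi t).
  by move=> /H[/= fd _]; exact: is_derive_line.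
have phi0 t : `|t| < e -> phi 0 <= phi t.
  by move=> /H[/= _]; rewrite /phi scale0r addr0.
have dphi0 : dphi 0 = 0.
  have ltN : - e <= e by lra.
  have [_ E0] : is_derive (0 : R) (1 : R) (phi : R -> R^o) 0.
    apply: derive1_at_min ltN _ _ _.
    - move=> t te; apply: ex_derive; apply: phid.
      by rewrite ltr_norml !(itvP te).
    - by rewrite in_itv/=; apply/andP; split; lra.
    - by move=> t te; apply: phi0; rewrite ltr_norml !(itvP te).
  have [_ E1] : is_derive (0 : R) (1 : R) (phi : R -> R^o) (dphi 0).
    by apply: phid; rewrite normr0.
  by rewrite -E1 E0.
have dfx : df x = 0 by move: dphi0; rewrite /dphi scale0r addr0.
split=> //; rewrite leNgt; apply/negP => d20.
have : is_derive (0 : R) (1 : R) (dphi : R -> R^o) d2.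
  by apply: is_derive_line; rewrite scale0r addr0.
move=> [ddphi d2E].
have : (fun h => h^-1 *: ((dphi \o shift 0) (h *: 1) - dphi 0)) @ 0^' --> d2.
  by rewrite -d2E; exact: ddphi.
move=> /cvgr_lt /(_ 0 d20); rewrite near_withinE => /nbhs_ballP[e' /= e'0 neg].
have dneg t : 0 < t -> t < e' -> dphi t < 0.
  move=> t0 te; have := neg t; rewrite /ball /= sub0r normrN gtr0_norm//.
  move=> /(_ te); rewrite gt_eqF// => /(_ isT).
  rewrite dphi0 subr0 addr0 [t *: 1]mulr1 => h.
  have := mulr_gt0 t0 (_ : 0 < - (t^-1 *: dphi t)); rewrite oppr_gt0 => /(_ h).
  by rewrite mulrN oppr_gt0 mulrA mulfV ?mul1r// gt_eqF.
pose T := Num.min e e' / 2.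
have m0 : 0 < Num.min e e' by rewrite lt_min e0.
have T0 : 0 < T by rewrite divr_gt0.
have [Te Te'] : T < e /\ T < e'.
  by apply/andP; rewrite -lt_min /T; lra.
have [|| c /andP[c0 cT] cE] := @MVT _ phi dphi 0 T T0.
- move=> t tT; apply: phid.
  by rewrite gtr0_norm ?(itvP tT)// (lt_trans _ Te)// (itvP tT).
- apply: derivable_within_continuous => t tT; apply: ex_derive; apply: phid.
  by rewrite ger0_norm ?(itvP tT)// (le_lt_trans _ Te)// (itvP tT).
have := phi0 T; rewrite gtr0_norm// => /(_ Te); rewrite -subr_ge0 cE subr0.
by rewrite pmulr_lge0// leNgt dneg// (lt_trans _ Te').
Qed.

Lemma directional_MVT f x v :
    (forall t : R, 0 <= t <= 1 -> derivable f (x + t *: v) v) ->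
  exists2 t : R, 0 <= t <= 1 & f (x + v) - f x = 'D_v f (x + t *: v).
Proof.
move=> fd.
have phid (t : R) : 0 <= t <= 1 ->
    is_derive t (1 : R) (fun s : R => f (x + s *: v) : R^o)
      ('D_v f (x + t *: v)).
  by move=> /fd fdt; apply: is_derive_line; exact: derivableP.
have [|| c c01] := @MVT _ (fun s : R => f (x + s *: v))
  (fun t => 'D_v f (x + t *: v)) 0 1 ltr01.
- by move=> t t01; apply: phid; rewrite !ltW ?(itvP t01).
- apply: derivable_within_continuous => t t01; apply: ex_derive; apply: phid.
  by rewrite !(itvP t01).
rewrite scale1r scale0r addr0 subr0 mulr1 => cE.
by exists c => //; rewrite !ltW ?(itvP c01).
Qed.

End Calculus.

(** * Derivatives of quadratic test functions and the trace identity *)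

Section Algebra.
Context {R : realType}.

Section Derivatives.
Context {V : normedModType R}.
Implicit Types (f g : V -> R) (x v : V).

Lemma is_derive_addf f g x v (a b : R) :
    is_derive x v f a -> is_derive x v g b ->
  is_derive x v (fun y => f y + g y) (a + b).
Proof. by move=> fa gb; exact: is_deriveD. Qed.

Lemma is_derive_mulf f g x v (a b : R) :
    is_derive x v f a -> is_derive x v g b ->
  is_derive x v (fun y => f y * g y) (f x * b + g x * a).
Proof. by move=> fa gb; exact: is_deriveM. Qed.

Lemma is_derive_quad Y Z x v (al be a b d y z : R) :
    is_derive x v Y y -> is_derive x v Z z ->
  is_derive x v (fun p => quad al be a b d (Y p) (Z p))
    ((al + 2 * a * Y x + 2 * b * Z x) * y +
     (be + 2 * b * Y x + 2 * d * Z x) * z).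
Proof.
move=> Yy Zz; rewrite /quad.
have cst (k : R) : is_derive x v (fun=> k) 0 by exact: is_derive_cst.
have Y2 := is_derive_mulf Yy Yy; have Z2 := is_derive_mulf Zz Zz.
apply: is_derive_eq.
  repeat first [eassumption | eapply cst | eapply is_derive_addf
               | eapply is_derive_mulf].
by rewrite /GRing.scale /=; ring.
Qed.

Lemma is_derive_quad2 Y Z Y1 Z1 x v (al be a b d y z : R) :
    is_derive x v Y (Y1 x) -> is_derive x v Z (Z1 x) ->
    is_derive x v Y1 y -> is_derive x v Z1 z ->
  is_derive x v (fun p => (al + 2 * a * Y p + 2 * b * Z p) * Y1 p +
                          (be + 2 * b * Y p + 2 * d * Z p) * Z1 p)
    ((al + 2 * a * Y x + 2 * b * Z x) * y +
     (be + 2 * b * Y x + 2 * d * Z x) * z +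
     (2 * a * Y1 x ^+ 2 + 4 * b * Y1 x * Z1 x + 2 * d * Z1 x ^+ 2)).
Proof.
move=> Yy Zz Y1y Z1z.
have cst (k : R) : is_derive x v (fun=> k) 0 by exact: is_derive_cst.
apply: is_derive_eq.
  repeat first [eassumption | eapply cst | eapply is_derive_addf
               | eapply is_derive_mulf].
by rewrite /GRing.scale /=; ring.
Qed.

End Derivatives.

(* In an orthonormal frame whose third vector is [e3], [(xi, yi, zi)] are the
   tangent vectors [D_i F], [(nx, ny, nz)] is a unit normal, [(sx, sy, sz)] is
   [det g * tr (g^-1 D^2 F)], and [(1, gy, gz)] and [a, b, d] are the gradient
   and the Hessian coefficients of the test function. *)
Lemma translater_trace (x1 y1 z1 x2 y2 z2 nx ny nz sx sy sz gy gz a b d : R) :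
  let g11 := x1 * x1 + y1 * y1 + z1 * z1 in
  let g12 := x1 * x2 + y1 * y2 + z1 * z2 in
  let g22 := x2 * x2 + y2 * y2 + z2 * z2 in
  let H y z y' z' :=
    2 * a * y * y' + 2 * b * (y * z' + z * y') + 2 * d * z * z' in
  0 < g11 * g22 - g12 ^+ 2 ->
  nx * x1 + ny * y1 + nz * z1 = 0 -> nx * x2 + ny * y2 + nz * z2 = 0 ->
  nx ^+ 2 + ny ^+ 2 + nz ^+ 2 = 1 ->
  x1 + gy * y1 + gz * z1 = 0 -> x2 + gy * y2 + gz * z2 = 0 ->
  nx * sx + ny * sy + nz * sz = (g11 * g22 - g12 ^+ 2) * nz ->
  0 <= sx + gy * sy + gz * sz +
    (g22 * H y1 z1 y1 z1 - 2 * g12 * H y1 z1 y2 z2 + g11 * H y2 z2 y2 z2) ->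
  0 <= (1 + gy ^+ 2 + gz ^+ 2) * (2 * a + 2 * d + gz) -
       (2 * a * gy ^+ 2 + 4 * b * gy * gz + 2 * d * gz ^+ 2).
Proof.
move=> /= det0 n1 n2 nn G1 G2 nS minH.
have x1E : x1 = - (gy * y1 + gz * z1) by lra.
have x2E : x2 = - (gy * y2 + gz * z2) by lra.
(* [w] is the Jacobian of the projection to the [(Y, Z)] plane; the tangent plane being orthogonal
   to the gradient, the Gram determinant is [w ^+ 2 * G]. *)
pose w := y1 * z2 - z1 * y2; pose G := 1 + gy ^+ 2 + gz ^+ 2.
have detE : (x1 * x1 + y1 * y1 + z1 * z1) * (x2 * x2 + y2 * y2 + z2 * z2) -
  (x1 * x2 + y1 * y2 + z1 * z2) ^+ 2 = w ^+ 2 * G.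
  by rewrite x1E x2E /w /G; ring.
rewrite detE in det0 nS.
have w0 : w != 0 by apply: contraTneq det0 => ->; rewrite expr0n/= mul0r ltxx.
(* The unit normal and the gradient are both orthogonal to the tangent plane, so the former is [nx]
   times the latter. *)
have nyE : ny = nx * gy.
  apply: (mulIf w0); apply/eqP; rewrite -subr_eq0; apply/eqP.
  have -> : ny * w - nx * gy * w = (nx * x1 + ny * y1 + nz * z1) * z2 -
    (nx * x2 + ny * y2 + nz * z2) * z1 by rewrite /w x1E x2E; ring.
  by rewrite n1 n2; ring.
have nzE : nz = nx * gz.
  apply: (mulIf w0); apply/eqP; rewrite -subr_eq0; apply/eqP.
  have -> : nz * w - nx * gz * w = (nx * x2 + ny * y2 + nz * z2) * y1 -
    (nx * x1 + ny * y1 + nz * z1) * y2 by rewrite /w x1E x2E; ring.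
  by rewrite n1 n2; ring.
have nx0 : nx != 0.
  apply/eqP => nx0; move: nn; rewrite nyE nzE nx0 !mul0r expr0n/= !addr0.
  by move/esym/eqP; rewrite oner_eq0.
have SE : sx + gy * sy + gz * sz = w ^+ 2 * G * gz.
  apply: (mulfI nx0); rewrite (_ : nx * (w ^+ 2 * G * gz) = w ^+ 2 * G * nz).
    by rewrite -nS nyE nzE; ring.
  by rewrite nzE; ring.
have w2 : 0 < w ^+ 2 by rewrite exprn_even_gt0.
rewrite -(pmulr_rge0 _ w2); apply: le_trans minH _.
rewrite SE le_eqVlt; apply/orP; left; apply/eqP.
by rewrite /w /G x1E x2E; ring.
Qed.

End Algebra.

(** * The curvature equation in a chart *)

Section Frame.
Context {R : realType}.
Implicit Types (n u v : 'rV[R]_3).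

Let i0 : 'I_3 := Ordinal (isT : 0 < 3)%N.
Let i1 : 'I_3 := Ordinal (isT : 1 < 3)%N.
Let i2 : 'I_3 := Ordinal (isT : 2 < 3)%N.

Lemma dotE u v : dot u v = u 0 i0 * v 0 i0 + u 0 i1 * v 0 i1 + u 0 i2 * v 0 i2.
Proof.
rewrite /dot !big_ord_recl big_ord0 addr0 addrA.
by congr (_ * _ + _ * _ + _ * _); congr (_ 0 _); apply: val_inj.
Qed.

Lemma dotC u v : dot u v = dot v u.
Proof. by rewrite !dotE; ring. Qed.

Lemma dotDr u v w : dot u (v + w) = dot u v + dot u w.
Proof. by rewrite !dotE !mxE; ring. Qed.

Lemma dotZr u (k : R) v : dot u (k *: v) = k * dot u v.
Proof. by rewrite !dotE !mxE; ring. Qed.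

Lemma dotZl u (k : R) v : dot (k *: u) v = k * dot u v.
Proof. by rewrite dotC dotZr dotC. Qed.

Lemma dot_e3 u : dot e3 u = u 0 i2.
Proof. by rewrite dotE !mxE /=; ring. Qed.

Lemma dot_ge0 u : 0 <= dot u u.
Proof. by rewrite dotE -!expr2 !addr_ge0// sqr_ge0. Qed.

Lemma dot_eq0 u : dot u u = 0 -> u = 0.
Proof.
rewrite dotE => uu.
have u0 i : u 0 i = 0.
  have : u 0 i ^+ 2 = 0; last by move=> /eqP; rewrite sqrf_eq0 => /eqP.
  have := sqr_ge0 (u 0 i0); have := sqr_ge0 (u 0 i1); have := sqr_ge0 (u 0 i2).
  case: i => [[|[|[|//]]] ilt] ? ? ?.
  - by rewrite (_ : Ordinal _ = i0); [lra|exact: val_inj].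
  - by rewrite (_ : Ordinal _ = i1); [lra|exact: val_inj].
  - by rewrite (_ : Ordinal _ = i2); [lra|exact: val_inj].
by apply/matrixP => i j; rewrite ord1 u0 mxE.
Qed.

Definition rot n : 'rV[R]_3 :=
  \row_i (if i == i0 then - n 0 i1 else if i == i1 then n 0 i0 else 0).

Lemma dot_frame n u v : dot n n = 1 -> dot n e3 = 0 ->
  dot u v = dot n u * dot n v + dot (rot n) u * dot (rot n) v +
            dot e3 u * dot e3 v.
Proof.
rewrite (dotC n e3) !dot_e3 !(dotE n) !(dotE (rot n)) dotE !mxE /= => nn n2.
rewrite -[u 0 i0 * v 0 i0]mul1r -[u 0 i1 * v 0 i1]mul1r -nn n2.
by ring.
Qed.

Lemma frame_inj n u v : dot n n = 1 -> dot n e3 = 0 ->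
  dot n u = dot n v -> dot (rot n) u = dot (rot n) v -> dot e3 u = dot e3 v ->
  u = v.
Proof.
move=> nn n3 e1 e2 e3'; apply/eqP; rewrite -subr_eq0 -scaleN1r; apply/eqP.
apply: dot_eq0; rewrite (dot_frame _ _ nn n3) !(dotDr, dotZr) e1 e2 e3'; ring.
Qed.

(** For vectors orthogonal to [n] the Gram determinant is the square of this determinant, by
    Lagrange's identity. *)
Lemma projected_det_neq0 n u v : dot n n = 1 -> dot n e3 = 0 ->
    dot n u = 0 -> dot n v = 0 -> 0 < dot u u * dot v v - dot u v ^+ 2 ->
  dot (rot n) u * dot e3 v - dot (rot n) v * dot e3 u != 0.
Proof.
move=> nn n3 u0 v0; rewrite (dot_frame u u nn n3) (dot_frame v v nn n3).
rewrite (dot_frame u v nn n3) u0 v0.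
move: (dot (rot n) u) (dot (rot n) v) (dot e3 u) (dot e3 v) => a b c d.
rewrite (_ : _ - _ ^+ 2 = (a * d - b * c) ^+ 2); last by ring.
by apply: contraTneq => ->; rewrite expr0n/= ltxx.
Qed.

End Frame.

Section Parametrization.
Context {R : realType}.
Implicit Types (f g : 'rV[R]_2 -> 'rV[R]_3) (y v : 'rV[R]_2) (l nu : 'rV[R]_3).

Lemma is_derive_dot l g y v : derivable g y v ->
  is_derive y v (fun x => dot l (g x)) (dot l ('D_v g y)).
Proof.
move=> gd; have gij i : is_derive y v (fun x => g x 0 i) ('D_v g y 0 i).
  by rewrite derive_mx// mxE; apply: derivableP; move/derivable_mxP: gd.
rewrite /dot.
have -> : (fun x => \sum_(i < 3) l 0 i * g x 0 i) =
    \sum_(i < 3) (fun x => l 0 i * g x 0 i).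
  by apply: funext => x; rewrite fct_sumE.
exact: is_derive_sum.
Qed.

Lemma derive_comb f y (a b : R) : differentiable f y ->
  'D_(a *: basis_vec 0 + b *: basis_vec 1) f y =
  a *: 'D_(basis_vec 0) f y + b *: 'D_(basis_vec 1) f y.
Proof. by move=> fd; rewrite !deriveE// linearD !linearZ. Qed.

Lemma derive2_comb f y (a b : R) (v := a *: basis_vec 0 + b *: basis_vec 1) :
    (\forall x \near y, differentiable f x) ->
    (forall w, differentiable ('D_w f) y) ->
  'D_v ('D_v f) y =
    a ^+ 2 *: 'D_(basis_vec 0) ('D_(basis_vec 0) f) y +
    (a * b) *: ('D_(basis_vec 0) ('D_(basis_vec 1) f) y +
                'D_(basis_vec 1) ('D_(basis_vec 0) f) y) +
    b ^+ 2 *: 'D_(basis_vec 1) ('D_(basis_vec 1) f) y.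
Proof.
move=> fd f2d.
have fd2 w u : derivable ('D_w f) y u by exact: diff_derivable.
pose f0 : 'rV[R]_2 -> 'rV[R]_3 := 'D_(basis_vec 0) f.
pose f1 : 'rV[R]_2 -> 'rV[R]_3 := 'D_(basis_vec 1) f.
pose af0 : 'rV[R]_2 -> 'rV[R]_3 := fun x => a *: f0 x.
pose bf1 : 'rV[R]_2 -> 'rV[R]_3 := fun x => b *: f1 x.
pose Df : 'rV[R]_2 -> 'rV[R]_3 := 'D_v f.
(* The first-order formula is needed on a neighbourhood, so that it can be differentiated once
   more. *)
have near_comb : \forall x \near y, Df x = (af0 + bf1) x.
  by apply: filterS fd => x fx; exact: derive_comb.
have E : 'D_v Df y = 'D_v (af0 + bf1) y := near_eq_derive v near_comb.
transitivity ('D_v (af0 + bf1) y); first exact: E.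
have da : derivable af0 y v by exact: (derivableZ (fd2 _ _)).
have db : derivable bf1 y v by exact: (derivableZ (fd2 _ _)).
have Za : 'D_v af0 y = a *: 'D_v f0 y := deriveZ a (fd2 _ _).
have Zb : 'D_v bf1 y = b *: 'D_v f1 y := deriveZ b (fd2 _ _).
have alg (p q r s : 'rV[R]_3) :
    a *: (a *: p + b *: q) + b *: (a *: r + b *: s) =
    a ^+ 2 *: p + (a * b) *: (r + q) + b ^+ 2 *: s.
  rewrite !scalerDr !scalerA !expr2 (mulrC b a) -!addrA; congr (_ + _).
  by rewrite addrCA.
apply: etrans (deriveD da db) _; apply: etrans (congr2 +%R Za Zb) _.
apply: etrans (alg _ _ _ _).
exact: (congr2 (fun p q => a *: p + b *: q)
  (derive_comb a b (f2d (basis_vec 0))) (derive_comb a b (f2d (basis_vec 1)))).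
Qed.

(** The nonzero vector [dot X1 X1 *: X0 - dot X0 X1 *: X1] has squared length [dot X1 X1] times the
    Gram determinant. *)
Lemma gram_det_gt0 (X0 X1 : 'rV[R]_3) :
    (forall a b : R, a *: X0 + b *: X1 = 0 -> a = 0 /\ b = 0) ->
  0 < dot X0 X0 * dot X1 X1 - dot X0 X1 ^+ 2.
Proof.
move=> D0.
have pos a b : b != 0 \/ a != 0 ->
    0 < dot (a *: X0 + b *: X1) (a *: X0 + b *: X1).
  move=> ab; rewrite lt_neqAle dot_ge0 andbT eq_sym.
  apply/eqP => /dot_eq0/D0[a0 b0].
  by case: ab; rewrite ?a0 ?b0 eqxx.
have := pos 0 1 (or_introl (oner_neq0 _)); rewrite scale0r add0r scale1r => g11.
have := pos (dot X1 X1) (- dot X0 X1) (or_intror (lt0r_neq0 g11)).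
rewrite !(dotDr, dotZr) !(dotC (_ + _)) !(dotDr, dotZr) (dotC X1 X0).
move=> h; rewrite -(pmulr_rgt0 _ g11); apply: (lt_le_trans h).
by rewrite le_eqVlt; apply/orP; left; apply/eqP; ring.
Qed.

Lemma first_form_det f y : differentiable f y -> injective ('d f y) ->
  0 < dot ('D_(basis_vec 0) f y) ('D_(basis_vec 0) f y) *
      dot ('D_(basis_vec 1) f y) ('D_(basis_vec 1) f y) -
      dot ('D_(basis_vec 0) f y) ('D_(basis_vec 1) f y) ^+ 2.
Proof.
move=> fd inj; apply: gram_det_gt0 => a b.
rewrite -derive_comb// deriveE// -(linear0 ('d f y)) => /inj /matrixP h.
by have := h 0 0; have := h 0 1; rewrite !mxE/= !(mulr0, mulr1, addr0, add0r).
Qed.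

Lemma char_poly_sum (S : 'M[R]_2) k1 k2 :
  char_poly S = ('X - k1%:P) * ('X - k2%:P) -> k1 + k2 = S 0 0 + S 1 1.
Proof.
move=> SE; have := @char_poly_trace _ 2 S isT; rewrite SE /=.
have -> : ('X - k1%:P) * ('X - k2%:P) =
    'X^2 - (k1 + k2) *: 'X + (k1 * k2)%:P :> {poly R}.
  by rewrite -mul_polyC polyCM polyCD; ring.
rewrite !coefE /= mulr1 sub0r addr0 => /oppr_inj ->.
rewrite /mxtrace !big_ord_recl big_ord0 addr0.
by congr (_ + S _ _); apply: val_inj.
Qed.

Lemma det2E (A : 'M[R]_2) : \det A = A 0 0 * A 1 1 - A 0 1 * A 1 0.
Proof.
rewrite (expand_det_row _ 0) !big_ord_recl big_ord0 addr0 /cofactor.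
rewrite !det_mx11 !mxE.
have l1 : lift 0 0 = 1 :> 'I_2 by exact: val_inj.
have l0 : lift (lift ord0 ord0) 0 = 0 :> 'I_2 by exact: val_inj.
by rewrite l0 l1 /= expr0 mul1r expr1 mulN1r mulrN.
Qed.

Lemma mulmx2E (A B : 'M[R]_2) i j :
  (A *m B) i j = A i 0 * B 0 j + A i 1 * B 1 j.
Proof.
rewrite mxE !big_ord_recl big_ord0 addr0.
by congr (_ + A _ _ * B _ _); apply: val_inj.
Qed.

(** The left side is the trace of [adj g * h], with [h = g * S] and [adj g * g = det g]. *)
Lemma trace_invmx_mul (g h : 'M[R]_2) : g 1 0 = g 0 1 ->
    0 < g 0 0 * g 1 1 - g 0 1 ^+ 2 ->
  let S := invmx g *m h in
  g 1 1 * h 0 0 - g 0 1 * (h 0 1 + h 1 0) + g 0 0 * h 1 1 =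
  (g 0 0 * g 1 1 - g 0 1 ^+ 2) * (S 0 0 + S 1 1).
Proof.
move=> g10 det0 S.
have gS : g *m S = h.
  by rewrite mulmxA mulmxV ?mul1mx// unitmxE det2E unitfE g10 -expr2 lt0r_neq0.
by clearbody S; rewrite -gS !mulmx2E g10; ring.
Qed.

Lemma mean_curvature_trace f nu y H :
  let g i j := dot ('D_(basis_vec i) f y) ('D_(basis_vec j) f y) in
  let h i j := - dot ('D_(basis_vec i) ('D_(basis_vec j) f) y) nu in
  0 < g 0 0 * g 1 1 - g 0 1 ^+ 2 -> is_mean_curvature f nu y H ->
  g 1 1 * h 0 0 - g 0 1 * (h 0 1 + h 1 0) + g 0 0 * h 1 1 =
  (g 0 0 * g 1 1 - g 0 1 ^+ 2) * H.
Proof.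
move=> g h; have gE i j : first_form f y i j = g i j by rewrite mxE.
have hE i j : second_form f nu y i j = h i j by rewrite mxE.
have g10 : first_form f y 1 0 = first_form f y 0 1 by rewrite !gE; exact: dotC.
rewrite -!gE -!hE => det0 [k1 [k2 [/char_poly_sum -> ->]]].
exact: trace_invmx_mul.
Qed.

End Parametrization.

(** * Variations of the test function in a chart *)

Section ChartTouching.
Context {R : realType}.
Context (n : 'rV[R]_3) (f : 'rV[R]_2 -> 'rV[R]_3) (y : 'rV[R]_2).
Let m := rot n.

(** [D] and [W] are variables so that the expansions [derive_comb] and [derive2_comb] can be plugged
    in. *)
Lemma second_variation (al be a b d : R) v D W :
    (\forall x \near y, differentiable f x) -> differentiable ('D_v f) y ->
    (\forall x \near y,
      dot n (f y) + quad al be a b d (dot m (f y)) (dot e3 (f y)) <=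
      dot n (f x) + quad al be a b d (dot m (f x)) (dot e3 (f x))) ->
  let gy := al + 2 * a * dot m (f y) + 2 * b * dot e3 (f y) in
  let gz := be + 2 * b * dot m (f y) + 2 * d * dot e3 (f y) in
  'D_v f y = D -> 'D_v ('D_v f) y = W ->
  dot n D + (gy * dot m D + gz * dot e3 D) = 0 /\
  0 <= dot n W + (gy * dot m W + gz * dot e3 W +
       (2 * a * dot m D ^+ 2 + 4 * b * dot m D * dot e3 D +
        2 * d * dot e3 D ^+ 2)).
Proof.
move=> fd f2d minf gy gz DE WE; subst D W; set W := 'D_v ('D_v f) y.
pose Df : 'rV[R]_2 -> 'rV[R]_3 := 'D_v f.
pose du x := dot n (Df x) +
  ((al + 2 * a * dot m (f x) + 2 * b * dot e3 (f x)) * dot m (Df x) +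
   (be + 2 * b * dot m (f x) + 2 * d * dot e3 (f x)) * dot e3 (Df x)).
have dDf l : is_derive y v (fun x => dot l (Df x)) (dot l W).
  by apply: is_derive_dot; exact: diff_derivable.
have df l x : differentiable f x ->
    is_derive x v (fun x => dot l (f x)) (dot l (Df x)).
  by move=> fx; apply: is_derive_dot; exact: diff_derivable.
have fy : differentiable f y by exact: nbhs_singleton fd.
have d1 : \forall x \near y, is_derive x v (fun x => dot n (f x) +
    quad al be a b d (dot m (f x)) (dot e3 (f x))) (du x).
  apply: filterS fd => x fx.
  by apply: is_derive_addf; [exact: df|apply: is_derive_quad; exact: df].
have d2 := is_derive_addf (dDf n)
  (is_derive_quad2 al be a b d (df m y fy) (df e3 y fy) (dDf m) (dDf e3)).
exact: (second_derivative_test d1 d2 minf).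
Qed.

Context (nn : dot n n = 1) (n3 : dot n e3 = 0).

Lemma variation_trace (X0 X1 P00 P01 P10 P11 nu : 'rV[R]_3) (gy gz a b d : R) :
    let g00 := dot X0 X0 in let g01 := dot X0 X1 in let g11 := dot X1 X1 in
    0 < g00 * g11 - g01 ^+ 2 ->
    dot nu X0 = 0 -> dot nu X1 = 0 -> dot nu nu = 1 ->
    g11 * - dot P00 nu - g01 * (- dot P01 nu + - dot P10 nu) +
      g00 * - dot P11 nu = (g00 * g11 - g01 ^+ 2) * - dot nu e3 ->
    (forall s t : R,
       let D := s *: X0 + t *: X1 in
       let W := s ^+ 2 *: P00 + (s * t) *: (P01 + P10) + t ^+ 2 *: P11 in
       dot n D + (gy * dot m D + gz * dot e3 D) = 0 /\
       0 <= dot n W + (gy * dot m W + gz * dot e3 W +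
         (2 * a * dot m D ^+ 2 + 4 * b * dot m D * dot e3 D +
          2 * d * dot e3 D ^+ 2))) ->
  0 <= (1 + gy ^+ 2 + gz ^+ 2) * (2 * a + 2 * d + gz) -
       (2 * a * gy ^+ 2 + 4 * b * gy * gz + 2 * d * gz ^+ 2).
Proof.
move=> g00 g01 g11 det0 n0 n1 nunu mc var.
have dF u v := dot_frame u v nn n3.
pose S := g11 *: P00 - g01 *: (P01 + P10) + g00 *: P11.
have SE l :
    dot l S = g11 * dot l P00 - g01 * (dot l P01 + dot l P10) + g00 * dot l P11.
  by rewrite /S -scaleNr !(dotDr, dotZr); ring.
have g00E :
    g00 = dot n X0 * dot n X0 + dot m X0 * dot m X0 + dot e3 X0 * dot e3 X0.
  exact: dF.
have g01E :
    g01 = dot n X0 * dot n X1 + dot m X0 * dot m X1 + dot e3 X0 * dot e3 X1.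
  exact: dF.
have g11E :
    g11 = dot n X1 * dot n X1 + dot m X1 * dot m X1 + dot e3 X1 * dot e3 X1.
  exact: dF.
have g11_ge0 : 0 <= g11 by exact: dot_ge0.
clearbody g00 g01 g11.
have := @translater_trace R (dot n X0) (dot m X0) (dot e3 X0)
  (dot n X1) (dot m X1) (dot e3 X1) (dot n nu) (dot m nu) (dot e3 nu)
  (dot n S) (dot m S) (dot e3 S) gy gz a b d; rewrite -g00E -g01E -g11E.
apply=> //.
- by rewrite -(dF nu X0).
- by rewrite -(dF nu X1).
- by rewrite !expr2 -(dF nu nu).
- have [+ _] := var 1 0; rewrite scale1r scale0r addr0; lra.
- have [+ _] := var 0 1; rewrite scale1r scale0r add0r; lra.
- by rewrite -(dF nu S) SE (dotC e3) !(dotC nu); rewrite !(dotC nu) in mc; lra.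
have g11_gt0 : 0 < g11.
  rewrite lt_neqAle g11_ge0 andbT; apply/eqP => g110.
  by move: det0; rewrite -g110 mulr0 sub0r oppr_gt0 ltNge sqr_ge0.
(* The directions [X1] and [g11 *: X0 - g01 *: X1] are orthogonal. The second variation along the
   latter, plus the determinant times that along [X1], is [g11] times the trace against the adjugate
   of the first form. *)
have [_ /(mulr_ge0 (ltW det0)) B1] := var 0 1.
have [_ B2] := var g11 (- g01).
rewrite -(pmulr_rge0 _ g11_gt0); apply: le_trans (addr_ge0 B2 B1) _.
rewrite !SE !(dotDr, dotZr) le_eqVlt; apply/orP; left; apply/eqP.
by ring.
Qed.

End ChartTouching.

(** * Local injectivity of two coordinates of a parametrization *)

Section LocalInjectivity.
Context {R : realType}.
Implicit Types (f : 'rV[R]_2 -> 'rV[R]_3) (y u v : 'rV[R]_2) (l : 'rV[R]_3).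

Lemma basis_decomp v : v = v 0 0 *: basis_vec 0 + v 0 1 *: basis_vec 1.
Proof.
apply/matrixP => i j; rewrite ord1 !mxE/=; case: j => [[|[|//]] jlt] /=.
  by rewrite mulr1 mulr0 addr0; congr (v 0 _); exact: val_inj.
by rewrite mulr1 mulr0 add0r; congr (v 0 _); exact: val_inj.
Qed.

Lemma ball_segment y u v (r t : R) : 0 <= t <= 1 -> ball y r u -> ball y r v ->
  ball y r (u + t *: (v - u)).
Proof.
move=> /andP[t0 t1]; rewrite -!ball_normE /= => yu yv.
have -> : y - (u + t *: (v - u)) = (1 - t) *: (y - u) + t *: (y - v).
  by apply/matrixP => i j; rewrite !mxE; ring.
apply: le_lt_trans (ler_normD _ _) _; rewrite !normrZ !ger0_norm ?subr_ge0//.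
have [->|tn0] := eqVneq t 0; first by rewrite subr0 mul1r mul0r addr0.
have tpos : 0 < t by rewrite lt_neqAle eq_sym tn0.
have yv' : 0 < r - `|y - v| by rewrite subr_gt0.
have := mulr_gt0 tpos yv'.
have : 0 <= (1 - t) * (r - `|y - u|) by rewrite mulr_ge0 ?subr_ge0// ltW.
lra.
Qed.

Lemma closed_half_ball y (r : R) : 0 < r -> closed_ball y (r / 2) `<=` ball y r.
Proof.
move=> r0; rewrite closed_ballE ?divr_gt0// => x yx.
have yxr : `|y - x| < r by apply: (le_lt_trans yx); lra.
by rewrite -ball_normE.
Qed.

Lemma compact_closed_ball y (r : R) : 0 < r -> compact (closed_ball y r).
Proof.
move=> r0; apply: bounded_closed_compact; last exact: closed_ball_closed.
exists (`|y| + r); split; first exact: num_real.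
rewrite closed_ballE// => N rN x yx; rewrite /= (le_trans _ (ltW rN))//.
have -> : x = y - (y - x) by rewrite opprB addrC subrK.
by rewrite (le_trans (ler_normB _ _))// lerD2l.
Qed.

Lemma cvg_dot (T : Type) (G : set_system T) (FG : Filter G)
    (g : T -> 'rV[R]_3) l (w : 'rV[R]_3) :
  g @ G --> w -> (fun x => dot l (g x)) @ G --> dot l w.
Proof.
move=> gw; have gi i : (fun x => g x 0 i) @ G --> w 0 i.
  exact: (cvg_comp _ (fun M : 'rV[R]_3 => M 0 i) gw
                   (@coord_continuous _ _ _ 0 i w)).
have lgi i : (fun x => l 0 i * g x 0 i) @ G --> l 0 i * w 0 i.
  by apply: cvgM (gi i); exact: cvg_cst.
rewrite (funext (fun x => dotE l (g x))) dotE.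
by apply: cvgD (lgi _); exact: (cvgD (lgi _) (lgi _)).
Qed.

(** The mean value theorem on the segment from [u] to [v], applied to each coordinate, gives a
    homogeneous linear system for [v - u], which is nonsingular near [y]. *)
Lemma local_injectivity f y l l' (U : set 'rV[R]_2) : open U -> U y ->
    (forall x, U x -> differentiable f x) ->
    (forall i, {for y, continuous ('D_(basis_vec i) f)}) ->
    dot l ('D_(basis_vec 0) f y) * dot l' ('D_(basis_vec 1) f y) -
      dot l ('D_(basis_vec 1) f y) * dot l' ('D_(basis_vec 0) f y) != 0 ->
  exists2 r : R, 0 < r & ball y r `<=` U /\
    forall u v, ball y r u -> ball y r v -> dot l (f u) = dot l (f v) ->
      dot l' (f u) = dot l' (f v) -> u = v.
Proof.
move=> oU Uy fd cD det0.
(* The two rows are evaluated at independent points because the two mean value points may differ. *)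
pose G (z : 'rV[R]_2 * 'rV[R]_2) :=
  dot l ('D_(basis_vec 0) f z.1) * dot l' ('D_(basis_vec 1) f z.2) -
  dot l ('D_(basis_vec 1) f z.1) * dot l' ('D_(basis_vec 0) f z.2).
have c1 i k : (fun z : 'rV[R]_2 * 'rV[R]_2 =>
    dot k ('D_(basis_vec i) f z.1)) @ (y, y) --> dot k ('D_(basis_vec i) f y).
  have fs : fst @ (y, y) --> y by exact: cvg_fst.
  by apply: cvg_dot; exact: (cvg_comp _ _ fs (cD i)).
have c2 i k : (fun z : 'rV[R]_2 * 'rV[R]_2 =>
    dot k ('D_(basis_vec i) f z.2)) @ (y, y) --> dot k ('D_(basis_vec i) f y).
  have fs : snd @ (y, y) --> y by exact: cvg_snd.
  by apply: cvg_dot; exact: (cvg_comp _ _ fs (cD i)).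
have cG : G @ (y, y) --> G (y, y).
  exact: (cvgB (cvgM (c1 0 l) (c2 1 l')) (cvgM (c1 1 l) (c2 0 l'))).
have [/= [P Q] /= [Py Qy] PQ] := cvgr_neq0 _ cG det0.
have : nbhs y (P `&` Q `&` U).
  by apply: filterI (open_nbhs_nbhs _) => //; exact: filterI.
move=> /nbhs_ballP[r /= r0 rPQ]; exists r => //; split.
  by move=> x /rPQ[].
move=> u v yu yv luv luv'.
have seg t : 0 <= t <= 1 -> ball y r (u + t *: (v - u)).
  by move=> ?; exact: ball_segment.
have mvt k : dot k (f u) = dot k (f v) -> exists2 x, ball y r x &
    (v - u) 0 0 * dot k ('D_(basis_vec 0) f x) +
    (v - u) 0 1 * dot k ('D_(basis_vec 1) f x) = 0.
  move=> kuv; have dk x : ball y r x ->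
      is_derive x (v - u) (fun x => dot k (f x))
      (dot k ('D_(v - u) f x)).
    by move=> /rPQ[_ /fd fx]; apply: is_derive_dot; exact: diff_derivable.
  have [t t01] := @directional_MVT _ _ (fun x => dot k (f x)) u (v - u)
    (fun t t01 => @ex_derive _ _ _ _ _ _ _ (dk _ (seg t t01))).
  rewrite [u + (v - u)]addrC subrK kuv subrr.
  have [_ ->] := dk _ (seg t t01) => D0.
  exists (u + t *: (v - u)); first exact: seg.
  have [_ /fd fx] := rPQ _ (seg t t01).
  have := derive_comb ((v - u) 0 0) ((v - u) 0 1) fx.
  rewrite -basis_decomp => dE.
  by rewrite -!dotZr -dotDr -dE -D0.
have [x yx e1] := mvt l luv; have [x' yx' e2] := mvt l' luv'.
have Gx : G (x, x') != 0.
  by apply: (PQ (x, x')); split; [have [[]] := rPQ _ yx|have [[]] := rPQ _ yx'].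
have cramer (v0 v1 a0 a1 b0 b1 : R) : a0 * b1 - a1 * b0 != 0 ->
    v0 * a0 + v1 * a1 = 0 -> v0 * b0 + v1 * b1 = 0 -> v0 = 0 /\ v1 = 0.
  move=> ab0 av bv; split; apply: (mulIf ab0); rewrite mul0r.
    rewrite (_ : v0 * _ = b1 * (v0 * a0 + v1 * a1) - a1 * (v0 * b0 + v1 * b1)).
      by rewrite av bv; ring.
    ring.
  rewrite (_ : v1 * _ = a0 * (v0 * b0 + v1 * b1) - b0 * (v0 * a0 + v1 * a1)).
    by rewrite av bv; ring.
  ring.
have [v0 v1] := cramer _ _ _ _ _ _ Gx e1 e2.
apply/esym/eqP; rewrite -subr_eq0 (basis_decomp (v - u)) v0 v1.
by rewrite !scale0r addr0.
Qed.

End LocalInjectivity.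

(** * Immersed translaters *)

Section Surface.
Context {R : realType} {M : topologicalType}.
Context (A : set (chart R M)) (F : M -> 'rV[R]_3).
Context (M_atlas : smooth_atlas A)
  (F_imm : immersion A F).

Lemma chart_smooth c u : A c -> ccod c u ->
  differentiable (F \o param c) u /\
  forall w, differentiable ('D_w (F \o param c)) u.
Proof.
move=> Ac cu; have [/(_ c Ac) smF _] := F_imm.
have Uu : (ccod c `&` param c @^-1` setT) u by split.
have [d1 d2] := smF 2%N; split; first exact: d1.
by move=> w; have [d3 _] := d2 w; exact: d3.
Qed.

Lemma near_ccod (c : chart R M) u : ccod c u -> \forall x \near u, ccod c x.
Proof. by move=> cu; apply: open_nbhs_nbhs; split=> //; exact: ccod_open. Qed.

Lemma near_cdom (c : chart R M) p : cdom c p -> \forall q \near p, cdom c q.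
Proof. by move=> cp; apply: open_nbhs_nbhs; split=> //; exact: cdom_open. Qed.

Lemma continuous_immersion : continuous F.
Proof.
move=> p; have [c Ac cp] := M_atlas.1 p.
have [fd _] := chart_smooth Ac (coord_ccod cp).
have cf : {for Defs.coord c p, continuous (F \o param c)}.
  exact: differentiable_continuous.
have cc : {for p, continuous (Defs.coord c)} by exact: coord_cts.
have Fp : (F \o param c) \o Defs.coord c @ p --> F p.
  by rewrite -[X in _ --> F X](coordK cp); exact: (cvg_comp _ _ cc cf).
apply: cvg_trans Fp; apply: near_eq_cvg; near=> q => /=.
rewrite coordK//; near: q; exact: near_cdom.
Unshelve. all: by end_near. Qed.

Lemma continuous_height l : continuous (fun p => dot l (F p)).
Proof. by move=> p; apply: cvg_dot; exact: continuous_immersion. Qed.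

Lemma pull_min (u : M -> R) (c : chart R M) p :
    cdom c p -> (\forall q \near p, u p <= u q) ->
  \forall x \near Defs.coord c p, u (param c (Defs.coord c p)) <= u (param c x).
Proof.
move=> cp minu; rewrite coordK//.
have pc : param c @ Defs.coord c p --> p.
  rewrite -[X in _ --> X](coordK cp); exact: (param_cts (coord_ccod cp)).
exact: (pc _ minu).
Qed.

Context (n : 'rV[R]_3)
  (nn : dot n n = 1) (n3 : dot n e3 = 0).
Let X p := dot n (F p).
Let Y p := dot (rot n) (F p).
Let Z p := dot e3 (F p).

Lemma touching_translater : translater A F -> touching X Y Z.
Proof.
move=> tr al be a b d p minu /=.
have [c Ac cp] := M_atlas.1 p.
have cu := coord_ccod cp; set y := Defs.coord c p in cu.
have py : param c y = p by exact: coordK.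
pose f := F \o param c.
have fd : \forall x \near y, differentiable f x.
  by apply: filterS (near_ccod cu) => x cx; have [] := chart_smooth Ac cx.
have [fy f2d] := chart_smooth Ac cu.
have minf := pull_min cp minu.
have [D [nu [oD Dp [nusm nu1 nuT] mc]]] := tr p.
rewrite -py in Dp.
have det0 := first_form_det fy (F_imm.2 _ _ Ac cu).
have tr0 := mean_curvature_trace det0 (mc _ _ Ac cu Dp).
apply: (variation_trace nn n3 det0 (nuT _ _ Ac cu Dp _) (nuT _ _ Ac cu Dp _)
  (nu1 _ Dp) tr0).
move=> s t.
have C1 := derive_comb s t fy; have C2 := derive2_comb s t fd f2d.
have := second_variation fd (f2d (s *: basis_vec 0 + t *: basis_vec 1)) minf
  C1 C2.
by rewrite /f /= py.
Qed.

(** At a minimum of [X] the tangent plane is orthogonal to [n], so [(Y, Z)] has invertible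
    differential there. *)
Lemma locally_injective_min p : (forall q, X p <= X q) ->
  locally_injective_at Y Z p.
Proof.
move=> minX.
have [c Ac cp] := M_atlas.1 p.
have cu := coord_ccod cp; set y := Defs.coord c p in cu.
pose f := F \o param c.
have fd : \forall x \near y, differentiable f x.
  by apply: filterS (near_ccod cu) => x cx; have [] := chart_smooth Ac cx.
have [fy f2d] := chart_smooth Ac cu.
(* With all coefficients zero, [second_variation] yields the first-order condition [Xv]. *)
have minf : \forall x \near y,
    dot n (f y) + quad 0 0 0 0 0 (dot (rot n) (f y)) (dot e3 (f y)) <=
    dot n (f x) + quad 0 0 0 0 0 (dot (rot n) (f x)) (dot e3 (f x)).
  apply: filterS fd => x _; rewrite /quad !(mul0r, mulr0) !addr0 /f /= coordK//.
  exact: minX.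
have Xv v : dot n ('D_v f y) = 0.
  have [+ _] := second_variation fd (f2d v) minf erefl erefl.
  by rewrite !(mul0r, mulr0, addr0).
have det0 := first_form_det fy (F_imm.2 _ _ Ac cu).
have J0 : dot (rot n) ('D_(basis_vec 0) f y) * dot e3 ('D_(basis_vec 1) f y) -
    dot (rot n) ('D_(basis_vec 1) f y) * dot e3 ('D_(basis_vec 0) f y) != 0.
  exact: (projected_det_neq0 nn n3 (Xv _) (Xv _) det0).
have [r r0 [rU inj]] := local_injectivity (@ccod_open _ _ c) cu
  (fun x cx => (chart_smooth Ac cx).1)
  (fun i => differentiable_continuous (f2d (basis_vec i))) J0.
pose B := closed_ball y (r / 2).
have r20 : 0 < r / 2 by rewrite divr_gt0.
have Br : B `<=` ball y r by exact: closed_half_ball.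
have cB : compact B by exact: compact_closed_ball.
(* Halving the radius leaves the closed ball inside the ball of injectivity, so its image is a
   compact sheet. *)
exists (param c @` B), (cdom c `&` Defs.coord c @^-1` ball y (r / 2)); split.
- apply: continuous_compact => //.
  apply: continuous_in_subspaceT => x /set_mem Bx.
  by apply: param_cts; exact: rU (Br _ Bx).
- rewrite openE => q [/= cq yq]; apply: filterI; first exact: near_cdom.
  by apply: (coord_cts cq); apply: open_nbhs_nbhs; split; [exact: ball_open|].
- by split=> //=; exact: ballxx.
- move=> q [/= cq yq]; exists (Defs.coord c q); last exact: coordK.
  by rewrite /B; apply: subset_closed_ball.
- move=> _ _ [u Bu <-] [v Bv <-] eY eZ; congr param.
  by apply: inj; [exact: Br|exact: Br| |].
Qed.

End Surface.

(** * Consequences of properness and periodicity *)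

Section Global.
Context {R : realType} {M : topologicalType}.
Context (F : M -> 'rV[R]_3) (n : 'rV[R]_3)
  (nn : dot n n = 1) (n3 : dot n e3 = 0).

Lemma dot_rot_e3 : dot (rot n) e3 = 0.
Proof. by rewrite dotC dot_e3 mxE. Qed.

Lemma dot_e3_e3 : dot e3 e3 = 1 :> R.
Proof. by rewrite dot_e3 mxE. Qed.

(** The sup norm is the absolute value [t] of one coordinate, and [t <= 1 + t ^+ 2]. *)
Lemma norm_le_dot (x : 'rV[R]_3) : `|x| <= 1 + dot x x.
Proof.
have [x0|/mx_norm_neq0[[i j] xE]] := eqVneq (mx_norm x) 0.
  by rewrite [`|x|]x0; have := dot_ge0 x; lra.
rewrite [`|x|]xE /= ord1.
have : x 0 j * x 0 j <= dot x x.
  rewrite /dot (bigD1 j)//= lerDl; apply: sumr_ge0 => k _.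
  by rewrite -expr2 sqr_ge0.
rewrite -expr2 -(real_normK (num_real (x 0 j))).
by have := sqr_ge0 (`|x 0 j| - 1); have := normr_ge0 (x 0 j); nra.
Qed.

Lemma boxes_compact_proper : proper_map F ->
  boxes_compact (fun p => dot n (F p)) (fun p => dot (rot n) (F p))
                (fun p => dot e3 (F p)).
Proof.
move=> prF L.
pose K := [set x : 'rV[R]_3 |
  [/\ `|dot n x| <= L, `|dot (rot n) x| <= L & `|dot e3 x| <= L]].
apply: (prF K); apply: bounded_closed_compact.
  exists (1 + (L ^+ 2 + L ^+ 2 + L ^+ 2)); split; first exact: num_real.
  move=> N LN x [nx mx zx] /=; rewrite (le_trans (norm_le_dot x))//.
  apply: le_trans (ltW LN); rewrite lerD2l (dot_frame x x nn n3).
  have sq (t : R) : `|t| <= L -> t * t <= L ^+ 2.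
    move=> tL; rewrite -expr2 -(real_normK (num_real t)).
    by rewrite lerXn2r ?nnegrE// (le_trans _ tL).
  by rewrite !lerD// sq.
have cl l : closed [set x : 'rV[R]_3 | `|dot l x| <= L].
  apply: closed_le_cts; last by move=> ?; exact: cst_continuous.
  move=> x; have dl : (fun x => dot l x) @ x --> dot l x.
    exact: (@cvg_dot _ _ (nbhs x) _ id l x (fun _ => id)).
  exact: (cvg_norm dl).
rewrite (_ : K = [set x | `|dot n x| <= L] `&`
    ([set x | `|dot (rot n) x| <= L] `&` [set x | `|dot e3 x| <= L])).
  by do ?apply: closedI.
by apply/seteqP; split=> x /=; [case|case=> ? []].
Qed.

(** Periodicity concerns the image only, so a translation by several periods is iterated, choosing a
    new preimage at each step. *)
Lemma periodic_representative (a : R) p : 0 < a ->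
    range F = [set x + a *: e3 | x in range F] ->
  exists q, [/\ dot n (F q) = dot n (F p),
                dot (rot n) (F q) = dot (rot n) (F p) &
                0 <= dot e3 (F q) <= a].
Proof.
move=> a0 per.
have up q : exists q', F q' = F q + a *: e3.
  have : range F (F q + a *: e3) by rewrite per; exists (F q) => //; exists q.
  by case=> q' _ <-; exists q'.
have down q : exists q', F q' = F q - a *: e3.
  have : range F (F q) by exists q.
  by rewrite per => -[x [q' _ <-] <-]; exists q'; rewrite addrK.
have upn (k : nat) q : exists q', F q' = F q + (k%:R * a) *: e3.
  elim: k => [|k [q1 q1E]]; first by exists q; rewrite mul0r scale0r addr0.
  have [q2 q2E] := up q1; exists q2.
  by rewrite q2E q1E -addrA -scalerDl -natr1 mulrDl mul1r.
have downn (k : nat) q : exists q', F q' = F q - (k%:R * a) *: e3.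
  elim: k => [|k [q1 q1E]]; first by exists q; rewrite mul0r scale0r subr0.
  have [q2 q2E] := down q1; exists q2.
  by rewrite q2E q1E -addrA -opprD -scalerDl -natr1 mulrDl mul1r.
pose k := Num.floor (dot e3 (F p) / a).
have [q qE] : exists q, F q = F p - (k%:~R * a) *: e3.
  case: k => k; first exact: downn.
  (* A negative floor [Negz k] stands for [- (k + 1)], whence [k.+1] upward steps. *)
  have [q qE] := upn k.+1 p; exists q.
  by rewrite qE NegzE mulrNz mulNr scaleNr opprK.
exists q; rewrite qE -scaleNr !(dotDr, dotZr) n3 dot_rot_e3 dot_e3_e3.
rewrite !mulr0 !addr0 mulr1; split=> //.
have k1 : k%:~R * a <= dot e3 (F p) by rewrite -ler_pdivlMr// floor_le.
have k2 : dot e3 (F p) < (k + 1)%:~R * a by rewrite -ltr_pdivrMr// floorD1_gt.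
by move: k2; rewrite intrD mulrDl mul1r => k2; apply/andP; split; lra.
Qed.

End Global.

(** The plane contains the multiple [(c / dot n n) *: n] of its normal; staying in the plane after
    adding [e3] forces orthogonality. *)
Lemma vertical_plane_normal (R : realType) (n : 'rV[R]_3) (c : R) :
  n != 0 -> vertical_plane (plane n c) -> dot n e3 = 0.
Proof.
move=> n0 [_ [_ [_ _ par]]].
have nn0 : dot n n != 0 by apply: contra_neq n0; exact: dot_eq0.
have x0 : plane n c ((c / dot n n) *: n).
  by rewrite /plane /= dotZr divfK.
have := par _ 1 x0; rewrite /plane /= dotDr !dotZr divfK// mul1r.
lra.
Qed.

Theorem corollary12 (R : realType) (M : topologicalType)
    (A : set (chart R M)) (F : M -> 'rV[R]_3) (Hs : set 'rV[R]_3)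
    (M_surface : smooth_surface A)
    (M_nonempty : [set: M] !=set0)
    (M_connected : connected [set: M])
    (F_immersion : immersion A F)
    (F_proper : proper_map F)
    (F_translater : translater A F)
    (Hs_vertical : vertical_halfspace Hs)
    (F_in_Hs : range F `<=` Hs)
    (F_periodic : exists2 a : R, 0 < a &
       range F = [set x + a *: e3 | x in range F]) :
  vertical_plane (range F).
Proof.
have [_ _ M_atlas] := M_surface.
have [n0 [c [n0_neq0 HsE n0_vert]]] := Hs_vertical.
have [a a0 per] := F_periodic; have [p0 _] := M_nonempty.
have nn0 : 0 < dot n0 n0.
  rewrite lt_neqAle dot_ge0 andbT eq_sym.
  by apply: contra_neq n0_neq0; exact: dot_eq0.
pose k := (Num.sqrt (dot n0 n0))^-1.
have k0 : 0 < k by rewrite invr_gt0 sqrtr_gt0.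
pose n := k *: n0.
have n3 : dot n e3 = 0.
  by rewrite dotZl (vertical_plane_normal n0_neq0 n0_vert) mulr0.
have nn : dot n n = 1.
  rewrite dotZr dotZl mulrA -expr2 exprVn sqr_sqrtr ?mulVf ?gt_eqF//.
  exact: dot_ge0.
have n_ge p : k * c <= dot n (F p).
  have : Hs (F p) by apply: F_in_Hs; exists p.
  by rewrite HsE /halfspace /= dotZl ler_pM2l.
have [m [mE onto]] := touching_plane p0 M_connected
  (continuous_height M_atlas F_immersion (l := n))
  (continuous_height M_atlas F_immersion (l := rot n))
  (continuous_height M_atlas F_immersion (l := e3))
  (boxes_compact_proper nn n3 F_proper)
  (touching_translater M_atlas F_immersion nn n3 F_translater)
  (fun p => locally_injective_min M_atlas F_immersion nn n3 (p := p))
  n_ge (fun p => periodic_representative n3 p a0 per).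
have n_neq0 : n != 0.
  apply: contra_eq_neq nn => ->; rewrite dotE !mxE !mul0r !addr0 eq_sym.
  exact: oner_neq0.
(* Constancy of [X] gives one inclusion; for the other, [onto] supplies a surface point sharing [Y]
   and [Z] with [x], and [frame_inj] concludes. *)
have rangeE : range F = plane n m.
  apply/seteqP; split=> x; first by move=> [p _ <-]; exact: mE.
  move=> /= xm; have [p [Yp Zp]] := onto (dot (rot n) x) (dot e3 x).
  by exists p => //; apply: (frame_inj nn n3) => //; rewrite mE xm.
exists n, m; split=> //; rewrite rangeE => x t; rewrite /plane /= => <-.
by rewrite dotDr dotZr n3 mulr0 addr0.
Qed.
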